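(* Let $n\ge 1$, $G=SU(2)$, $\mathcal S=\{A\in SU(2):\operatorname{tr}A=0\}$, $K_{2n}=\{(A_1,\dots,A_{2n})\in\mathcal S^{2n}:A_1\cdots A_{2n}=I\}$ and $\Delta=\{(A,-A,A,-A,\dots,A,-A):A\in\mathcal S\}\subset K_{2n}$. There is a neighbourhood $U$ of $\Delta$ in $K_{2n}$ which is homeomorphic to the total space of a bundle $G\times_{\mathbb T}C(S^{2n-3}\times S^{2n-3})$ (for some continuous action of $\mathbb T$ on the cone fixing its vertex), where $C(S^{2n-3}\times S^{2n-3})$ is the cone over the product of two $(2n-3)$-dimensional spheres. The homeomorphism identifies $\Delta$ with the section of the bundle given by the vertex of the cone.
   Context: $\mathbb T\subset SU(2)$ is the circle of diagonal matrices; it is the isotropy subgroup of $J=\begin{pmatrix} i&0\\0&-i\end{pmatrix}\in\mathcal S$ under conjugation, so $\Delta\cong\mathcal S\cong G/\mathbb T$. For a $\mathbb T$-space $F$, $G\times_{\mathbb T}F$ is the quotient of $G\times F$ by $(gt,x)\sim(g,tx)$, a bundle over $G/\mathbb T$ with fibre $F$. For $n=1$, $S^{-1}=\emptyset$ and the cone over the empty set is a point (the vertex). *)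

(* Defs.v *)
From HB Require Import structures.
From mathcomp Require Import all_boot all_order all_algebra complex spectral.
From mathcomp Require Import generic_quotient.
From mathcomp Require Import all_classical all_reals all_analysis.

Set Implicit Arguments.
Unset Strict Implicit.
Unset Printing Implicit Defensive.

Import Order.TTheory GRing.Theory Num.Theory.
Import numFieldNormedType.Exports.
Local Open Scope classical_set_scope.
Local Open Scope ring_scope.
Local Open Scope sesquilinear_scope.
Local Open Scope quotient_scope.

(* The usual topology of the complex plane, given by the modulus; matrices    *)
(* over R[i] then carry the entrywise topology.                               *)
HB.instance Definition _ (R : rcfType) := PseudoPointedMetric.copy R[i] (R[i]^o).

Section SU2.
Variable R : realType.

Definition SU2_set : set 'M[R[i]]_2 :=
  [set A | A \is unitarymx /\ \det A = 1].

Definition SU2 : Type := SU2_set.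
HB.instance Definition _ := Topological.on SU2.

Lemma SU2P (A : SU2) : SU2_set (\val A).
Proof. exact: set_valP. Qed.

Lemma SU2_set1 : SU2_set 1.
Proof.
by split; [apply/unitarymxP; rewrite trmx1 map_mx1 mulmx1 | rewrite det1].
Qed.

Lemma SU2_setM A B : SU2_set A -> SU2_set B -> SU2_set (A *m B).
Proof.
move=> [uA dA] [uB dB]; split; first exact: mul_unitarymx.
by rewrite det_mulmx dA dB mulr1.
Qed.

Lemma SU2_setV A : SU2_set A -> SU2_set (A^t*).
Proof.
move=> [uA dA]; split; first by rewrite trmxC_unitary.
by rewrite det_map_mx det_tr dA rmorph1.
Qed.

Definition SU2_one : SU2 := exist _ 1 (mem_set SU2_set1).
Definition SU2_mul (A B : SU2) : SU2 :=
  exist _ (\val A *m \val B) (mem_set (SU2_setM (SU2P A) (SU2P B))).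
Definition SU2_inv (A : SU2) : SU2 :=
  exist _ ((\val A)^t*) (mem_set (SU2_setV (SU2P A))).

Fact SU2_mulA : associative SU2_mul.
Proof. by move=> A B C; apply: val_inj; rewrite /= mulmxA. Qed.

Fact SU2_mul1 : left_id SU2_one SU2_mul.
Proof. by move=> A; apply: val_inj; rewrite /= mul1mx. Qed.

Fact SU2_1mul : right_id SU2_one SU2_mul.
Proof. by move=> A; apply: val_inj; rewrite /= mulmx1. Qed.

Fact SU2_mulV : right_inverse SU2_one SU2_inv SU2_mul.
Proof.
by move=> A; apply: val_inj; have [/unitarymxP uA _] := SU2P A.
Qed.

Fact SU2_Vmul : left_inverse SU2_one SU2_inv SU2_mul.
Proof.
by move=> A; apply: val_inj; have [/unitarymxP uA _] := SU2P A; exact: mulmx1C.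
Qed.

HB.instance Definition _ :=
  isGroup.Build SU2 SU2_mulA SU2_mul1 SU2_1mul SU2_Vmul SU2_mulV.

Definition torus_set : set SU2 := [set t | is_diag_mx (\val t)].

Definition torus : Type := torus_set.
HB.instance Definition _ := Topological.on torus.
HB.instance Definition _ := SubChoice.on torus.

Fact torus_group_closed : group_closed (mem torus_set).
Proof.
split; first by apply/mem_set; exact: scalar_mx_is_diag.
move=> s t /set_mem /is_diag_mxP ds /set_mem /is_diag_mxP dt; apply/mem_set.
apply/is_diag_mxP => i j ij; rewrite !mxE.
apply: big1 => k _; rewrite !mxE.
have [ik|ik] := eqVneq i k; last by rewrite ds ?mul0r.
by rewrite dt ?rmorph0 ?mulr0 // -ik eq_sym.
Qed.
HB.instance Definition _ :=
  SubChoice_isSubGroup.Build _ _ torus torus_group_closed.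

End SU2.

Section associated_bundle.
Variables (R : realType) (F : topologicalType).

Record torus_action := TorusAction {
  tact :> torus R -> F -> F;
  tact1 : forall x, tact 1%g x = x;
  tactM : forall s t x, tact (s * t)%g x = tact s (tact t x);
  tact_continuous : continuous (fun p : torus R * F => tact p.1 p.2) }.

Variable a : torus_action.

(* p ~ q when p = (g t, x) and q = (g, t x) for some t; since torus is a      *)
(* group this is already an equivalence relation.                             *)
Definition bundle_eq (p q : SU2 R * F) : bool :=
  `[< exists t : torus R, p.1 = (q.1 * \val t)%g /\ q.2 = a t p.2 >].

Fact bundle_eq_refl : reflexive bundle_eq.
Proof. by move=> p; apply/asboolP; exists 1%g; rewrite mulg1 tact1. Qed.

Fact bundle_eq_sym : symmetric bundle_eq.
Proof.
suff H p q : bundle_eq p q -> bundle_eq q p.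
  by move=> p q; apply/idP/idP; exact: H.
move=> /asboolP[t [pq qp]]; apply/asboolP; exists t^-1%g; split.
  by rewrite pq gmulfV mulgK.
by rewrite qp -tactM mulVg tact1.
Qed.

Fact bundle_eq_trans : transitive bundle_eq.
Proof.
move=> q p r /asboolP[s [pq qp]] /asboolP[t [qr rq]]; apply/asboolP.
exists (t * s)%g; split; first by rewrite pq qr gmulfM mulgA.
by rewrite rq qp tactM.
Qed.

Definition bundle_rel :=
  EquivRel bundle_eq bundle_eq_refl bundle_eq_sym bundle_eq_trans.

Definition bundle := {eq_quot bundle_rel}.
HB.instance Definition _ := Topological.copy bundle (quotient_topology bundle).
HB.instance Definition _ := Quotient.on bundle.

Definition bundle_point (g : SU2 R) (x : F) : bundle := \pi_bundle (g, x).

End associated_bundle.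

Section cone.
Variables (R : realType) (X : topologicalType).

(* The cone is the quotient of the disjoint union of X * [0, 1] and a point   *)
(* that collapses X * {0} and the extra point to the vertex. The extra point  *)
(* matters only when X is empty: the cone is then reduced to its vertex.      *)
Definition cone_summand (b : bool) : topologicalType :=
  if b return topologicalType
  then (X * (`[0%R, 1%R]%classic : set R))%type else discrete_topology unit.

Definition at_vertex (p : {b : bool & cone_summand b}) : bool :=
  match p with
  | existT true xs => \val xs.2 == 0
  | existT false _ => true
  end.

Definition cone_eq (p q : {b : bool & cone_summand b}) : bool :=
  (p == q) || (at_vertex p && at_vertex q).

Fact cone_eq_refl : reflexive cone_eq.
Proof. by move=> p; rewrite /cone_eq eqxx. Qed.

Fact cone_eq_sym : symmetric cone_eq.
Proof. by move=> p q; rewrite /cone_eq eq_sym andbC. Qed.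

Fact cone_eq_trans : transitive cone_eq.
Proof.
move=> q p r /predU1P[-> //|/andP[vp vq]] /predU1P[<-|/andP[_ vr]].
  by rewrite /cone_eq vp vq orbT.
by rewrite /cone_eq vp vr orbT.
Qed.

Definition cone_rel := EquivRel cone_eq cone_eq_refl cone_eq_sym cone_eq_trans.

Definition cone := {eq_quot cone_rel}.
HB.instance Definition _ := Topological.copy cone (quotient_topology cone).
HB.instance Definition _ := Quotient.on cone.

Definition vertex : cone := \pi_cone (existT cone_summand false tt).

End cone.
Arguments vertex {R X}.

(* The unit sphere S^(d-1) of Euclidean R^d. The sum of squares is used since *)
(* the library norm on row vectors is the sup norm.                           *)
Definition sphere (R : realType) (d : nat) : set 'rV[R]_d :=
  [set v | \sum_(i < d) v 0 i ^+ 2 = 1].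
Arguments sphere R d : clear implicits.

Section K.
Variables (R : realType) (m : nat).

Definition traceless : set 'M[R[i]]_2 :=
  [set A | SU2_set A /\ \tr A = 0].

Definition K_set : set {ptws 'I_m -> 'M[R[i]]_2} :=
  [set A | (forall i, traceless (A i)) /\ \prod_(i < m) A i = 1].

Definition K : Type := K_set.
HB.instance Definition _ := Topological.on K.

(* Indices start at 0, so the entries of even index are the ones equal to A.  *)
Definition Delta : set K :=
  [set B | exists2 A, traceless A &
           forall i : 'I_m, \val B i = if odd i then - A else A].

End K.
Arguments Delta R m : clear implicits.

(* Main.v *)
Require Import Defs.
From mathcomp Require Import all_boot all_order all_algebra complex.
From mathcomp Require Import spectral generic_quotient ring lra zify.
From mathcomp Require Import all_classical all_reals all_analysis.

(* The partial products P_k = A_1 ... A_k form a closed 2n-gon of unit           *)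
(* quaternions in which consecutive vertices are orthogonal; on Delta the        *)
(* vertices are alternately 1 and A. Conjugate so that A_1 = J and rescale the   *)
(* vertices near 1 to (1 + i q_k) + z_k j and those near J to (r_k + i) + w_k j, *)
(* with z_k, w_k complex. The orthogonality relations then determine all q_k and *)
(* r_k and leave the single equation sum_k z_k . (w_k - w_(k-1)) = 0. With       *)
(* z_k = u_k + v_k and w_k - w_(k-1) = u_k - v_k it reads |u| = |v|, so the      *)
(* fibre over J is exactly a cone over a product of two spheres, on which        *)
(* diag(t, 1/t) multiplies u and v by t^2. The map from the bundle to K obtained *)
(* in this way is injective and continuous, hence an embedding since the bundle  *)
(* is compact, and every point of K close to Delta is in its image.              *)

Set Implicit Arguments.
Unset Strict Implicit.
Unset Printing Implicit Defensive.

Import Order.TTheory GRing.Theory Num.Theory.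
Import numFieldNormedType.Exports.
Local Open Scope classical_set_scope.
Local Open Scope ring_scope.
Local Open Scope sesquilinear_scope.
Local Open Scope quotient_scope.
Local Open Scope complex_scope.

Local Notation Re := complex.Re.
Local Notation Im := complex.Im.

(** * Continuity and compactness *)

Lemma compact_set_type (T : topologicalType) (A : set T) :
  compact A -> compact [set: A].
Proof.
move=> cA F FF _.
have FA : (set_val @ F) A.
  by apply: (@filterS _ F _ setT) => [x _|]; [exact: (set_valP x)|exact: filterT].
have [p [Ap clp]] := cA (set_val @ F) _ FA.
exists (exist _ p (mem_set Ap)); split => // U V FU [W [[W' oW' <-] W'p] WV].
have FvU : (set_val @ F) (set_val @` U).
  by apply: (@filterS _ F _ U) => // x Ux; exists x.
have [_ [[x Ux <-] W'x]] := clp _ _ FvU (open_nbhs_nbhs (conj oW' W'p)).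
by exists x; split => //; exact: WV.
Qed.

Lemma set_type_continuous (S T : topologicalType) (A : set T) (f : S -> A) :
  continuous (set_val \o f) -> continuous f.
Proof.
move=> /continuousP cf; apply/continuousP => _ [U oU <-].
exact: cf.
Qed.

Lemma set_val_continuous (T : topologicalType) (A : set T) :
  continuous (set_val : A -> T).
Proof. exact: initial_continuous. Qed.

Lemma hausdorff_separating (T : topologicalType) (R : realType) :
  (forall x y : T,
    (forall f : T -> R, continuous f -> f x = f y) -> x = y) ->
  hausdorff_space T.
Proof.
move=> sep x y clxy; apply: sep => f cf; apply: (@Rhausdorff R) => U V fU fV.
by have [z [? ?]] := clxy _ _ (cf x _ fU) (cf y _ fV); exists (f z).
Qed.

Lemma compact_lift_continuous (X Y Z : topologicalType) (f : X -> Y)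
    (g : Z -> X) :
  compact [set: X] -> hausdorff_space Y -> continuous f -> injective f ->
  continuous (f \o g) -> continuous g.
Proof.
move=> cX hY cf injf /continuous_closedP cfg.
apply/continuous_closedP => A clA.
have -> : g @^-1` A = (f \o g) @^-1` (f @` A).
  by apply/seteqP; split => z /= => [Az|[x Ax /injf <- //]]; exists (g z).
apply: cfg; apply: compact_closed => //.
apply: (@continuous_compact X Y f A); first exact: continuous_subspaceT.
by apply: (subclosed_compact clA cX).
Qed.

Lemma continuous_pair (S T U : topologicalType) (f : S -> T) (g : S -> U) :
  continuous f -> continuous g -> continuous (fun x => (f x, g x)).
Proof. by move=> cf cg x; apply: cvg_pair; [exact: cf|exact: cg]. Qed.

Lemma continuous_compose (S T U : topologicalType) (f : S -> T) (g : T -> U) :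
  continuous f -> continuous g -> continuous (fun x => g (f x)).
Proof. by move=> cf cg x; apply: continuous_comp; [exact: cf|exact: cg]. Qed.

Lemma continuous_fst (S T : topologicalType) : continuous (@fst S T).
Proof. by move=> p; exact: cvg_fst. Qed.

Lemma continuous_snd (S T : topologicalType) : continuous (@snd S T).
Proof. by move=> p; exact: cvg_snd. Qed.

Lemma mx_continuous (S T : topologicalType) (m n : nat) (f : S -> 'M[T]_(m, n)) :
  (forall i j, continuous (fun x => f x i j)) -> continuous f.
Proof.
move=> cf x U [P xP PU].
have : forall ij : 'I_m * 'I_n, \forall y \near x, P ij.1 ij.2 (f y ij.1 ij.2).
  by move=> [i j]; exact: (cf i j x _ (xP i j)).
move=> /filter_forall; apply: filterS => y Py; apply: PU => i j.
exact: (Py (i, j)).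
Qed.

Lemma ptws_continuous (S T : topologicalType) (I : Type)
    (f : S -> {ptws I -> T}) :
  (forall i, continuous (fun x => f x i)) -> continuous f.
Proof.
move=> cf x; apply/cvg_sup => i U [/= _ [[V oV <-] /= Vfx]] /filterS; apply.
exact: (cf i x _ (open_nbhs_nbhs (conj oV Vfx))).
Qed.

Section real_continuous.
Variables (S : topologicalType) (R : realType).
Implicit Types f g : S -> R.

Lemma real_continuousD f g :
  continuous f -> continuous g -> continuous (fun x => f x + g x).
Proof. by move=> cf cg x; apply: cvgD; [exact: cf|exact: cg]. Qed.

Lemma real_continuousM f g :
  continuous f -> continuous g -> continuous (fun x => f x * g x).
Proof. by move=> cf cg x; apply: cvgM; [exact: cf|exact: cg]. Qed.

Lemma real_continuousN f : continuous f -> continuous (fun x => - f x).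
Proof. by move=> cf x; apply: cvgN; exact: cf. Qed.

Lemma real_continuousB f g :
  continuous f -> continuous g -> continuous (fun x => f x - g x).
Proof. by move=> cf cg; apply: real_continuousD => //; exact: real_continuousN. Qed.

Lemma real_continuous_sum (I : Type) (r : seq I) (P : pred I) (F : I -> S -> R) :
  (forall i, continuous (F i)) ->
  continuous (fun x => \sum_(i <- r | P i) F i x).
Proof.
move=> cF x; apply: cvg_big => [y|i _]; last exact: cF.
exact: add_continuous.
Qed.

End real_continuous.

Lemma sphere_compact (R : realType) (d : nat) : compact (sphere R d).
Proof.
have cbox : compact
    [set v : 'rV[R]_d | forall i, v ord0 i \in `[(-1 : R), 1]].
  by apply: (@rV_compact _ _ (fun=> `[(-1 : R), 1]%classic)) => _;
    exact: segment_compact.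
apply: subclosed_compact cbox _ => [|v /= v1 i].
  have -> : sphere R d = (fun v : 'rV[R]_d => \sum_(i < d) v 0 i ^+ 2) @^-1` [set 1].
    by [].
  apply: closed_comp; last exact: closed_eq.
  move=> v _; apply: real_continuous_sum => i.
  by apply: real_continuousM; exact: coord_continuous.
rewrite in_itv /= -ler_norml -(@expr_le1 _ 2) // real_normK ?num_real // -v1.
by rewrite (bigD1 i) //= lerDl sumr_ge0 // => j _; exact: sqr_ge0.
Qed.

(** * Complex numbers and quaternions *)

Section complex_continuity.
Variable R : realType.
Local Notation C := R[i].

Lemma Re_continuous : continuous (@Re R : C -> R).
Proof.
move=> z U /nbhs_ballP[e /= e0 eU].
have : nbhs (z : C) (ball z e%:C) by apply: nbhsx_ballx; rewrite ltcR.
apply: (@filterS _ _ (nbhs_filter (z : C))) => w zw; apply: eU; rewrite /ball /=.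
move: zw; rewrite /ball /= => zw.
have := le_lt_trans (normc_ge_Re (z - w)) zw.
by rewrite ltcR raddfB.
Qed.

Lemma Im_continuous : continuous (@Im R : C -> R).
Proof.
move=> z U /nbhs_ballP[e /= e0 eU].
have : nbhs (z : C) (ball z e%:C) by apply: nbhsx_ballx; rewrite ltcR.
apply: (@filterS _ _ (nbhs_filter (z : C))) => w zw; apply: eU; rewrite /ball /=.
move: zw; rewrite /ball /= => zw.
have -> : Im z - Im w = Re (- 'i * (z - w)).
  by case: z w {zw} => [a b] [c d] /=; ring.
have := normc_ge_Re (- 'i * (z - w)).
rewrite normrM normrN normc_def /= expr0n /= expr1n add0r sqrtr1 mul1r.
by move=> /le_lt_trans/(_ zw); rewrite ltcR.
Qed.

Variable S : topologicalType.

Lemma complex_continuous (f g : S -> R) :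
  continuous f -> continuous g -> continuous (fun x => f x +i* g x : C).
Proof.
move=> cf cg x U.
move=> /nbhs_ballP [e /= e0 eU].
have [r r0 er] : exists2 r : R, 0 < r & e = r%:C.
  by move: e0; case: e eU => r s _; rewrite ltcE /= => /andP[/eqP -> ?]; exists r.
have r20 : 0 < r / 2 by rewrite divr_gt0.
move/cvgrPdist_lt: (cf x) => /(_ _ r20) fx.
move/cvgrPdist_lt: (cg x) => /(_ _ r20) gx.
suff : \forall y \near x, U (f y +i* g y) by [].
near=> y; apply: eU; rewrite er /ball /=.
have fy : `|f x - f y| < r / 2 by near: y.
have gy : `|g x - g y| < r / 2 by near: y.
have -> : (f x +i* g x) - (f y +i* g y) = (f x - f y)%:C + 'i * (g x - g y)%:C.
  by apply/eqP; rewrite eq_complex /=; apply/andP; split; apply/eqP; ring.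
apply: le_lt_trans (ler_normD _ _) _.
rewrite normrM [`|'i|]normc_def /= expr0n /= expr1n add0r sqrtr1 mul1r.
rewrite !normc_def /= !expr0n !addr0 !sqrtr_sqr -rmorphD ltcR.
by rewrite [r]splitr ltrD.
Unshelve. all: by end_near. Qed.

Lemma complex_continuous_ReIm (f : S -> C) :
  continuous (fun x => Re (f x)) -> continuous (fun x => Im (f x)) ->
  continuous f.
Proof.
move=> cr ci.
have -> : f = fun x => Re (f x) +i* Im (f x) by apply/funext => x; case: (f x).
exact: complex_continuous.
Qed.

Lemma complex_continuousRe (f : S -> C) : continuous f -> continuous (fun x => Re (f x)).
Proof. by move=> cf x; apply: continuous_comp; [exact: cf|exact: Re_continuous]. Qed.

Lemma complex_continuousIm (f : S -> C) : continuous f -> continuous (fun x => Im (f x)).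
Proof. by move=> cf x; apply: continuous_comp; [exact: cf|exact: Im_continuous]. Qed.

Lemma complex_continuousD (f g : S -> C) :
  continuous f -> continuous g -> continuous (fun x => f x + g x).
Proof.
move=> cf cg; apply: complex_continuous_ReIm.
  under eq_fun do rewrite raddfD /=.
  by apply: real_continuousD; exact: complex_continuousRe.
under eq_fun do rewrite raddfD /=.
by apply: real_continuousD; exact: complex_continuousIm.
Qed.

Lemma complex_ReM (x y : C) : Re (x * y) = Re x * Re y - Im x * Im y.
Proof. by case: x y => [a b] [c d]. Qed.

Lemma complex_ImM (x y : C) : Im (x * y) = Re x * Im y + Im x * Re y.
Proof. by case: x y => [a b] [c d]. Qed.

Lemma complex_continuousM (f g : S -> C) :
  continuous f -> continuous g -> continuous (fun x => f x * g x).
Proof.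
move=> cf cg; apply: complex_continuous_ReIm.
  under eq_fun do rewrite complex_ReM.
  by apply: real_continuousB; apply: real_continuousM; 
    (exact: complex_continuousRe || exact: complex_continuousIm).
under eq_fun do rewrite complex_ImM.
by apply: real_continuousD; apply: real_continuousM; 
    (exact: complex_continuousRe || exact: complex_continuousIm).
Qed.

Lemma complex_continuousN (f : S -> C) : continuous f -> continuous (fun x => - f x).
Proof.
move=> cf; apply: complex_continuous_ReIm.
  under eq_fun do rewrite raddfN /=.
  by apply: real_continuousN; exact: complex_continuousRe.
under eq_fun do rewrite raddfN /=.
by apply: real_continuousN; exact: complex_continuousIm.
Qed.

Lemma complex_continuousJ (f : S -> C) : continuous f -> continuous (fun x => (f x)^*).
Proof.
move=> cf; apply: complex_continuous_ReIm.
  have -> : (fun x => Re (f x)^*) = (fun x => Re (f x)).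
    by apply/funext => x; case: (f x).
  exact: complex_continuousRe.
have -> : (fun x => Im (f x)^*) = (fun x => - Im (f x)).
  by apply/funext => x; case: (f x).
by apply: real_continuousN; exact: complex_continuousIm.
Qed.

Lemma complex_continuous_real (f : S -> R) : continuous f -> continuous (fun x => (f x)%:C).
Proof. by move=> cf; apply: complex_continuous => //; exact: cst_continuous. Qed.

Lemma mx_continuous_entry m n (f : S -> 'M[C]_(m, n)) i j :
  continuous f -> continuous (fun x => f x i j).
Proof.
move=> cf x U fU; apply: (cf x [set M : 'M[C]_(m, n) | U (M i j)]).
exists (fun i' j' => if (i' == i) && (j' == j) then U else setT).
  move=> i' j'; case: ifPn => [/andP[/eqP -> /eqP ->] //|_]; exact: filterT.
by move=> M /(_ i j); rewrite !eqxx.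
Qed.

End complex_continuity.

Section quaternions.
Variable R : realType.
Local Notation C := R[i].

(* The quaternion a + b j. *)
Definition qmx (a b : C) : 'M[C]_2 :=
  \matrix_(i, j) if i == 0 then (if j == 0 then a else b)
                 else (if j == 0 then - b^* else a^*).

Definition qnorm2 (a b : C) : R := Re a ^+ 2 + Im a ^+ 2 + Re b ^+ 2 + Im b ^+ 2.

Lemma mx2P (A B : 'M[C]_2) : A 0 0 = B 0 0 -> A 0 1 = B 0 1 ->
  A 1 0 = B 1 0 -> A 1 1 = B 1 1 -> A = B.
Proof.
move=> h00 h01 h10 h11; apply/matrixP => i j.
have I2 (k : 'I_2) : k = 0 \/ k = 1.
  by case: k => [[|[|//]]] ?; [left|right]; exact: val_inj.
by case: (I2 i) (I2 j) => -> [] ->.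
Qed.

Lemma mulmx2E (A B : 'M[C]_2) i j : (A *m B) i j = A i 0 * B 0 j + A i 1 * B 1 j.
Proof.
rewrite mxE !big_ord_recl big_ord0 addr0; congr (_ + A i _ * B _ j); exact: val_inj.
Qed.

Lemma qmx_inj a b a' b' : qmx a b = qmx a' b' -> a = a' /\ b = b'.
Proof.
by move=> /matrixP h; have := h 0 0; have := h 0 1; rewrite !mxE /=.
Qed.

Lemma qmxM a b c d : qmx a b *m qmx c d = qmx (a * c - b * d^*) (a * d + b * c^*).
Proof.
apply: mx2P; rewrite mulmx2E !mxE /=;
  case: a b c d => [a1 a2] [b1 b2] [c1 c2] [d1 d2]; 
  apply/eqP; rewrite eq_complex /=; apply/andP; split; apply/eqP; ring.
Qed.

Lemma qmxJ a b : (qmx a b)^t* = qmx a^* (- b).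
Proof.
apply: mx2P; rewrite !mxE /=; case: a b => [a1 a2] [b1 b2];
  by apply/eqP; rewrite eq_complex /=; apply/andP; split; apply/eqP; ring.
Qed.

Lemma qmxZ (k : R) a b : k%:C *: qmx a b = qmx (k%:C * a) (k%:C * b).
Proof.
apply: mx2P; rewrite !mxE /=; case: a b => [a1 a2] [b1 b2];
  by apply/eqP; rewrite eq_complex /=; apply/andP; split; apply/eqP; ring.
Qed.

Lemma mxtrace2 (A : 'M[C]_2) : \tr A = A 0 0 + A 1 1.
Proof.
rewrite /mxtrace !big_ord_recl big_ord0 addr0; congr (_ + A _ _); exact: val_inj.
Qed.

Lemma qmx_tr a b : \tr (qmx a b) = (Re a *+ 2)%:C.
Proof.
rewrite mxtrace2 !mxE /=; case: a => a1 a2.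
by apply/eqP; rewrite eq_complex /=; apply/andP; split; apply/eqP; ring.
Qed.

Lemma det2 (A : 'M[C]_2) : \det A = A 0 0 * A 1 1 - A 0 1 * A 1 0.
Proof.
rewrite (expand_det_row _ 0) !big_ord_recl big_ord0 addr0 /cofactor.
rewrite [row' _ _]mx11_scalar det_scalar1.
rewrite [X in _ + _ * (_ * \det X)]mx11_scalar det_scalar1.
rewrite !mxE /= expr0 expr1 mul1r mulN1r mulrN.
by congr (_ * A _ _ - A _ _ * A _ _); exact: val_inj.
Qed.

Lemma qmx_det a b : \det (qmx a b) = (qnorm2 a b)%:C.
Proof.
rewrite det2 !mxE /= /qnorm2; case: a b => [a1 a2] [b1 b2].
by apply/eqP; rewrite eq_complex /=; apply/andP; split; apply/eqP; ring.
Qed.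

Lemma qmx1 : qmx 1 0 = 1.
Proof.
by apply: mx2P; rewrite !mxE /= ?oppr0 //; apply/eqP;
  rewrite eq_complex /= ?oppr0 !eqxx.
Qed.

Lemma SU2_qmx a b : qnorm2 a b = 1 -> SU2_set (qmx a b).
Proof.
move=> ab; split; last by rewrite qmx_det ab.
apply/unitarymxP; rewrite qmxJ qmxM -[1%:M]/1 -qmx1; congr qmx;
  apply/eqP; rewrite eq_complex /=; move: ab; rewrite /qnorm2;
  case: a b => [a1 a2] [b1 b2] /= ab; apply/andP; split; apply/eqP; rewrite -?ab; ring.
Qed.

Lemma SU2_qmxP (A : 'M[C]_2) :
  SU2_set A -> A = qmx (A 0 0) (A 0 1) /\ qnorm2 (A 0 0) (A 0 1) = 1.
Proof.
move=> [/unitarymxP uA dA].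
have e : A = qmx (A 0 0) (A 0 1).
  have uA' : forall i j, (A *m A^t*) i j = 1%:M i j by rewrite uA.
  have := uA' 0 1; have := uA' 1 1.
  rewrite !mulmx2E !mxE /= => h11 h01.
  move: dA; rewrite det2 => dA.
  apply: mx2P; rewrite !mxE //=.
    apply: (can_inj (@conjcK R)); rewrite raddfN /= conjcK.
    have -> : (A 1 0)^* = (A 1 0)^* * (A 0 0 * A 1 1 - A 0 1 * A 1 0).
      by rewrite dA mulr1.
    transitivity (A 1 1 * (A 0 0 * (A 1 0)^* + A 0 1 * (A 1 1)^*)
       - A 0 1 * (A 1 0 * (A 1 0)^* + A 1 1 * (A 1 1)^*)); first by ring.
    by rewrite h01 h11 mulr0 mulr1 add0r.
  apply: (can_inj (@conjcK R)); rewrite conjcK.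
  have -> : (A 1 1)^* = (A 1 1)^* * (A 0 0 * A 1 1 - A 0 1 * A 1 0).
    by rewrite dA mulr1.
  transitivity (- A 1 0 * (A 0 0 * (A 1 0)^* + A 0 1 * (A 1 1)^*)
     + A 0 0 * (A 1 0 * (A 1 0)^* + A 1 1 * (A 1 1)^*)); first by ring.
  by rewrite h01 h11 mulr0 mulr1 add0r.
by split => //; apply: (@complexI R); rewrite -qmx_det -e dA.
Qed.

End quaternions.

(** * Right-angled spherical polygons *)

Ltac complex_ring := apply/eqP; rewrite eq_complex /=; apply/andP; split; apply/eqP; ring.

Section polygon.
Variable R : realType.
Local Notation C := R[i].
Implicit Types (z y : nat -> C) (a b c d : C).

Definition dotc a b : R := Re a * Re b + Im a * Im b.

Lemma dotcC a b : dotc a b = dotc b a.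
Proof. by rewrite /dotc ![Re a * _]mulrC ![Im a * _]mulrC. Qed.

Lemma dotcDr a b c : dotc a (b + c) = dotc a b + dotc a c.
Proof. by case: a b c => [a1 a2] [b1 b2] [c1 c2]; rewrite /dotc /=; ring. Qed.

Lemma dotcMM (u : C) a b : dotc (u * a) (u * b) = dotc u u * dotc a b.
Proof. by case: u a b => [u1 u2] [a1 a2] [b1 b2]; rewrite /dotc /=; ring. Qed.

Lemma dotc_ge0 a : 0 <= dotc a a.
Proof. by rewrite addr_ge0 // -expr2 sqr_ge0. Qed.

Lemma qnorm2E a b : qnorm2 a b = dotc a a + dotc b b.
Proof. by rewrite /qnorm2 /dotc; ring. Qed.

Lemma qnorm2Z (k : R) a b : qnorm2 (k%:C * a) (k%:C * b) = k ^+ 2 * qnorm2 a b.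
Proof. by rewrite /qnorm2; case: a b => [a1 a2] [b1 b2] /=; ring. Qed.

Definition odd_diag z y i : R := - \sum_(l < i.+1) dotc (z l) (y l).
Definition odd_off y i : C := \sum_(l < i.+1) y l.
Definition even_diag z y i : R := - odd_diag z y i - dotc (z i) (odd_off y i).

(* The rescaled vertices of the polygon; y is the sequence of differences of w. *)
Definition vtx z y k : C * C :=
  if odd k then (odd_diag z y k./2 +i* 1, odd_off y k./2)
  else (1 +i* even_diag z y k./2, z k./2).

Definition vertex_mx z y k : 'M[C]_2 :=
  ((Num.sqrt (qnorm2 (vtx z y k).1 (vtx z y k).2))^-1)%:C *:
  qmx (vtx z y k).1 (vtx z y k).2.

Lemma qnorm2_vtx_gt0 z y k : 0 < qnorm2 (vtx z y k).1 (vtx z y k).2.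
Proof.
by rewrite /vtx /qnorm2; case: ifP => _ /=; rewrite expr1n; nra.
Qed.

Lemma vertex_mxE z y k : let: c := (Num.sqrt (qnorm2 (vtx z y k).1 (vtx z y k).2))^-1 in
  vertex_mx z y k = qmx (c%:C * (vtx z y k).1) (c%:C * (vtx z y k).2).
Proof. by rewrite /vertex_mx qmxZ. Qed.

Lemma vertex_mx_SU2 z y k : SU2_set (vertex_mx z y k).
Proof.
rewrite vertex_mxE; apply: SU2_qmx.
rewrite qnorm2Z exprVn sqr_sqrtr; last exact/ltW/qnorm2_vtx_gt0.
by rewrite mulVf // gt_eqF // qnorm2_vtx_gt0.
Qed.

Lemma mxtraceJ_qmx a b c d :
  \tr ((qmx a b)^t* *m qmx c d) = ((dotc a c + dotc b d) *+ 2)%:C.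
Proof.
rewrite qmxJ qmxM qmx_tr /dotc; congr ((_ *+ 2)%:C).
by case: a b c d => [a1 a2] [b1 b2] [c1 c2] [d1 d2] /=; ring.
Qed.

Lemma odd_diagS z y i :
  odd_diag z y i.+1 = odd_diag z y i - dotc (z i.+1) (y i.+1).
Proof. by rewrite /odd_diag big_ord_recr /= opprD. Qed.

Lemma odd_offS y i : odd_off y i.+1 = odd_off y i + y i.+1.
Proof. by rewrite /odd_off big_ord_recr. Qed.

Lemma vtx_orth z y k :
  dotc (vtx z y k).1 (vtx z y k.+1).1 + dotc (vtx z y k).2 (vtx z y k.+1).2 = 0.
Proof.
rewrite /vtx /= uphalf_half; case: ifP => ok /=; rewrite ?add1n ?add0n.
  by rewrite /dotc /= /even_diag odd_diagS odd_offS /dotc raddfD raddfD /=; ring.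
by rewrite /dotc /= /even_diag /dotc; ring.
Qed.

Lemma vertex_mx_orth z y k : \tr ((vertex_mx z y k)^t* *m vertex_mx z y k.+1) = 0.
Proof.
rewrite !vertex_mxE mxtraceJ_qmx.
set c := (Num.sqrt _)^-1; set d := (Num.sqrt _)^-1.
have := vtx_orth z y k; move: (vtx z y k) (vtx z y k.+1) => [a b] [a' b'] /= h.
rewrite (_ : dotc _ _ + _ = c * d * (dotc a a' + dotc b b')).
  by rewrite h mulr0 mul0rn.
by rewrite /dotc; case: a b a' b' {h} => [a1 a2] [b1 b2] [c1 c2] [d1 d2] /=; ring.
Qed.

Definition Jmx : 'M[C]_2 := qmx 'i 0.

Lemma vertex_mx0 z y : z 0%N = 0 -> y 0%N = 0 -> vertex_mx z y 0 = 1.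
Proof.
move=> z0 y0; rewrite vertex_mxE.
have -> : vtx z y 0 = (1, 0).
  rewrite /vtx /= /even_diag /odd_diag /odd_off !big_ord_recl !big_ord0 z0 y0.
  by rewrite /dotc /= !(mul0r, addr0, oppr0).
by rewrite /qnorm2 /= expr1n !expr0n /= !addr0 sqrtr1 invr1 !mul1r qmx1.
Qed.

Lemma vertex_mx1 z y : z 0%N = 0 -> y 0%N = 0 -> vertex_mx z y 1 = Jmx.
Proof.
move=> z0 y0; rewrite vertex_mxE.
have -> : vtx z y 1 = ('i, 0).
  rewrite /vtx /= /even_diag /odd_diag /odd_off !big_ord_recl !big_ord0 z0 y0.
  by rewrite /dotc /= !(mul0r, addr0, oppr0).
by rewrite /qnorm2 /= expr1n !expr0n /= !addr0 add0r sqrtr1 invr1 !mul1r.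
Qed.

Lemma vertex_mx_last n z y : z n = 0 -> y n = 0 ->
  \sum_(l < n) dotc (z l) (y l) = 0 -> vertex_mx z y (2 * n) = 1.
Proof.
move=> zn yn s0; rewrite vertex_mxE.
have -> : vtx z y (2 * n) = (1, 0).
  rewrite /vtx oddM /= mul2n doubleK zn /even_diag /odd_diag big_ord_recr /= s0 zn.
  by rewrite /dotc /= !(mul0r, addr0, oppr0).
by rewrite /qnorm2 /= expr1n !expr0n /= !addr0 sqrtr1 invr1 !mul1r qmx1.
Qed.

Lemma vtx_rot (u : C) z y k : dotc u u = 1 ->
  vtx (fun l => u * z l) (fun l => u * y l) k = ((vtx z y k).1, u * (vtx z y k).2).
Proof.
move=> u1.
have ho i : odd_off (fun l => u * y l) i = u * odd_off y i.
  by rewrite /odd_off mulr_sumr.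
have hd i : odd_diag (fun l => u * z l) (fun l => u * y l) i = odd_diag z y i.
  by rewrite /odd_diag; congr (- _); apply: eq_bigr => l _; rewrite dotcMM u1 mul1r.
by rewrite /vtx /even_diag !ho !hd dotcMM u1 mul1r; case: ifP.
Qed.

Lemma vertex_mx_rot (t : C) z y k : dotc t t = 1 ->
  vertex_mx (fun l => t ^+ 2 * z l) (fun l => t ^+ 2 * y l) k =
  qmx t 0 *m vertex_mx z y k *m (qmx t 0)^t*.
Proof.
move=> t1; have t21 : dotc (t ^+ 2) (t ^+ 2) = 1.
  by rewrite expr2 dotcMM t1 mul1r.
rewrite /vertex_mx vtx_rot //=; move: (vtx z y k) => [a b] /=.
have -> : qnorm2 a (t ^+ 2 * b) = qnorm2 a b.
  by rewrite !qnorm2E dotcMM t21 mul1r.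
rewrite -scalemxAr -scalemxAl qmxJ !qmxM.
rewrite oppr0 rmorph0 !mul0r !mulr0 !subr0 !addr0 add0r.
rewrite [X in qmx _ (_ * b * X)](_ : _ = t); last exact: conjcK.
congr (_ *: qmx _ _); last by rewrite expr2 mulrAC.
move: t1; rewrite /dotc; case: t a {t21} => [t1 t2] [a1 a2] /= h.
apply/eqP; rewrite eq_complex /=; apply/andP; split; apply/eqP;
  by rewrite -[LHS]mulr1 -h; ring.
Qed.

Lemma vertex_mx_inj n z y z' y' :
  (forall k, (k < 2 * n)%N -> vertex_mx z y k = vertex_mx z' y' k) ->
  forall l, (l < n)%N -> z l = z' l /\ y l = y' l.
Proof.
move=> h.
have c0 x (k : nat) x' : (Num.sqrt (qnorm2 (vtx x x' k).1 (vtx x x' k).2))^-1 != 0.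
  by rewrite invr_eq0 gt_eqF // sqrtr_gt0 qnorm2_vtx_gt0.
have cancelc (c : R) a b : c != 0 -> c%:C * a = c%:C * b -> a = b.
  move=> cn0 /mulfI; apply; apply: contra cn0 => /eqP[->]; exact: eqxx.
have hz l : (l < n)%N -> z l = z' l.
  move=> ln; have /h : (l.*2 < 2 * n)%N by rewrite mul2n ltn_double.
  rewrite !vertex_mxE => /qmx_inj.
  move: (c0 z l.*2 y) (c0 z' l.*2 y'); set c := (_)^-1; set c' := (_)^-1.
  rewrite /vtx odd_double doubleK /= => cn0 c'n0 [] [e _].
  have {}e : c = c' by move: e; rewrite !mulr1 !mul0r !subr0.
  by rewrite e => /cancelc; apply.
have hw l : (l < n)%N -> odd_off y l = odd_off y' l.
  move=> ln; have /h : (l.*2.+1 < 2 * n)%N by rewrite mul2n ltn_Sdouble.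
  rewrite !vertex_mxE => /qmx_inj.
  move: (c0 z l.*2.+1 y) (c0 z' l.*2.+1 y'); set c := (_)^-1; set c' := (_)^-1.
  rewrite /vtx /= odd_double /= uphalf_double /= => cn0 c'n0 [] [_ e].
  have {}e : c = c' by move: e; rewrite !mulr1 !mul0r !addr0.
  by rewrite e => /cancelc; apply.
move=> [|l] ln; split; try exact: hz.
  by have := hw _ ln; rewrite /odd_off !big_ord_recl !big_ord0 !addr0.
have := hw _ ln; rewrite !odd_offS (hw l (ltnW ln)).
exact: addrI.
Qed.

Lemma vertex_mx_surj n (p : nat -> C * C) z y :
  (forall k, (k <= 2 * n)%N -> qnorm2 (p k).1 (p k).2 = 1) ->
  (forall k, (k < 2 * n)%N ->
    dotc (p k).1 (p k.+1).1 + dotc (p k).2 (p k.+1).2 = 0) ->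
  p 0%N = (1, 0) -> p 1%N = ('i, 0) -> p (2 * n)%N = (1, 0) ->
  (forall i, (i < n)%N -> 0 < Re (p i.*2).1) ->
  (forall i, (i < n)%N -> 0 < Im (p i.*2.+1).1) ->
  (forall i, (i < n)%N -> z i = ((Re (p i.*2).1)^-1)%:C * (p i.*2).2) ->
  (forall i, (i < n)%N ->
    odd_off y i = ((Im (p i.*2.+1).1)^-1)%:C * (p i.*2.+1).2) ->
  (forall k, (k < 2 * n)%N -> vertex_mx z y k = qmx (p k).1 (p k).2) /\
  \sum_(l < n) dotc (z l) (y l) = 0.
Proof.
move=> p1 porth p0 pJ pn repos impos hz hw.
pose s k := if odd k then Im (p k).1 else Re (p k).1.
have s_gt0 k : (k < 2 * n)%N -> 0 < s k.
  move=> kn; rewrite /s -(odd_double_half k); case: (odd k) => /=.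
    by rewrite add1n /= odd_double /= impos // -ltn_Sdouble -mul2n; lia.
  by rewrite add0n odd_double repos //; lia.
pose N k := (((s k)^-1)%:C * (p k).1, ((s k)^-1)%:C * (p k).2).
have orthN k : (k.+1 < 2 * n)%N ->
    dotc (N k).1 (N k.+1).1 + dotc (N k).2 (N k.+1).2 = 0.
  move=> kn; have := porth k (ltnW kn).
  rewrite /N /=; move: (p k) (p k.+1) (s k) (s k.+1) => [a b] [a' b'] /= c c' h.
  transitivity (c^-1 * c'^-1 * (dotc a a' + dotc b b')); last by rewrite h mulr0.
  rewrite /dotc; case: a b a' b' {h} => [? ?] [? ?] [? ?] [? ?] /=; ring.
have sE i : s i.*2 = Re (p i.*2).1 by rewrite /s odd_double.
have sO i : s i.*2.+1 = Im (p i.*2.+1).1 by rewrite /s /= odd_double.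
have NE1 i : (i < n)%N -> Re (N i.*2).1 = 1.
  move=> ilt; rewrite /N sE complex_ReM /= mul0r subr0 mulVf // gt_eqF //.
  exact: repos.
have NO1 i : (i < n)%N -> Im (N i.*2.+1).1 = 1.
  move=> ilt; rewrite /N sO complex_ImM /= mul0r addr0 mulVf // gt_eqF //.
  exact: impos.
have NE2 i : (i < n)%N -> (N i.*2).2 = z i by move=> /hz ->; rewrite /N /= sE.
have NO2 i : (i < n)%N -> (N i.*2.+1).2 = odd_off y i.
  by move=> /hw ->; rewrite /N sO.
have orthE i : (i < n)%N ->
    Re (N i.*2.+1).1 + Im (N i.*2).1 + dotc (z i) (odd_off y i) = 0.
  move=> ilt; have /orthN : (i.*2.+1 < 2 * n)%N by lia.
  by rewrite NE2 // NO2 // /dotc NE1 // NO1 // mul1r mulr1 => <-.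
have oddP i : (i < n)%N -> odd_diag z y i = Re (N i.*2.+1).1.
  elim: i => [|i IH] ilt.
    rewrite /odd_diag big_ord_recl big_ord0 addr0 hz // p0 mulr0 /dotc /=.
    by rewrite !mul0r addr0 oppr0 /N /= pJ complex_ReM /= mulr0 mul0r subr0.
  rewrite odd_diagS IH //; last exact: ltnW.
  have := orthE _ ilt.
  have /orthN : (i.*2.+2 < 2 * n)%N by lia.
  rewrite -doubleS NE2 // NO2 ?odd_offS; last exact: ltnW.
  rewrite dotcDr {1}/dotc NE1 // NO1; last exact: ltnW.
  rewrite mul1r mulr1 (dotcC (odd_off y i)) => e1 e2.
  have := congr2 (fun u v => u - v) e1 e2; rewrite subr0 => e.
  by apply/eqP; rewrite -subr_eq0 -e; apply/eqP; ring.
have evenP i : (i < n)%N -> even_diag z y i = Im (N i.*2).1.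
  move=> ilt; rewrite /even_diag oddP //.
  by apply/eqP; rewrite eq_sym -subr_eq0 -(orthE _ ilt); apply/eqP; ring.
split; last first.
  have [n0|n_gt0] := posnP n; first by rewrite n0 big_ord0.
  have [m nm] : exists m : nat, n = m.+1 by exists n.-1; rewrite prednK.
  have mn : (m < n)%N by rewrite nm.
  have := oddP m mn; rewrite /odd_diag nm => /eqP; rewrite eqr_oppLR => /eqP ->.
  have mn2 : (m.*2.+1 < 2 * n)%N by lia.
  have := porth _ mn2; rewrite (_ : m.*2.+2 = (2 * n)%N); last by lia.
  rewrite pn /dotc /= !mulr0 !addr0 mulr1 => h.
  by rewrite /N /= complex_ReM /= h mulr0 mul0r subr0 oppr0.
move=> k kn.
have vN : vtx z y k = N k.
  rewrite /vtx -[k in RHS]odd_double_half; case: ifP => ok.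
    have kk : (k./2 < n)%N by lia.
    rewrite add1n oddP // -NO2 //; have := NO1 _ kk.
    by case: (N k./2.*2.+1) => [[? ?] ?] /= ->.
  have kk : (k./2 < n)%N by lia.
  rewrite add0n evenP // -NE2 //; have := NE1 _ kk.
  by case: (N k./2.*2) => [[? ?] ?] /= ->.
have sk := s_gt0 _ kn.
rewrite /vertex_mx vN /N /= qnorm2Z p1 ?(ltnW kn) // mulr1 sqrtr_sqr.
rewrite gtr0_norm ?invr_gt0 // invrK -qmxZ scalerA -rmorphM /= mulfV ?gt_eqF //.
by rewrite scale1r.
Qed.

End polygon.

(** * The cone as a subset of a vector space *)

Section coding.
Variables (R : realType) (n : nat).
Local Notation C := R[i].
Local Notation V := 'rV[R]_(2 * n - 2).
Implicit Types (u v w : V) (c : nat -> C).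

Definition coord_nat v k : R := if insub k is Some i then v 0 i else 0.

(* Index 0 is reserved for the two fixed vertices 1 and J of the polygon. *)
Definition seqC v l : C :=
  if l is l'.+1 then coord_nat v l'.*2 +i* coord_nat v l'.*2.+1 else 0.

Definition rowC c : V :=
  \row_i if odd i then Im (c (i./2).+1) else Re (c (i./2).+1).

Lemma coord_natE v (i : 'I_(2 * n - 2)) : coord_nat v i = v 0 i.
Proof. by rewrite /coord_nat valK. Qed.

Lemma coord_nat_out v k : (2 * n - 2 <= k)%N -> coord_nat v k = 0.
Proof. by move=> h; rewrite /coord_nat insubF // ltnNge h. Qed.

Lemma coord_natD u v k : coord_nat (u + v) k = coord_nat u k + coord_nat v k.
Proof. by rewrite /coord_nat; case: insubP => [i _ _|_]; rewrite ?mxE ?addr0. Qed.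

Lemma coord_natN v k : coord_nat (- v) k = - coord_nat v k.
Proof. by rewrite /coord_nat; case: insubP => [i _ _|_]; rewrite ?mxE ?oppr0. Qed.

Lemma seqC_out v l : (n <= l)%N -> seqC v l = 0.
Proof.
case: l => [//|l] nl; rewrite /= !coord_nat_out //; lia.
Qed.

Lemma seqCD u v l : seqC (u + v) l = seqC u l + seqC v l.
Proof. by case: l => [|l]; rewrite /= ?addr0 // !coord_natD. Qed.

Lemma seqCN v l : seqC (- v) l = - seqC v l.
Proof. by case: l => [|l]; rewrite /= ?oppr0 // !coord_natN. Qed.

Lemma seqC_rowC c l : c 0%N = 0 -> (forall k, (n <= k)%N -> c k = 0) ->
  seqC (rowC c) l = c l.
Proof.
move=> c0 cn; case: l => [|l] //.
have [nl|nl] := leqP n l.+1; first by rewrite seqC_out // cn.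
have h0 : (l.*2 < 2 * n - 2)%N by lia.
have h1 : (l.*2.+1 < 2 * n - 2)%N by lia.
rewrite /= -[l.*2]/(val (Ordinal h0)) -[(val _).+1]/(val (Ordinal h1)).
rewrite !coord_natE !mxE /= odd_double /= doubleK uphalf_double.
by case: (c l.+1).
Qed.

Lemma seqCK v : rowC (seqC v) = v.
Proof.
apply/rowP => i; rewrite mxE /= -coord_natE.
case: ifP => oi; congr coord_nat; rewrite -[RHS]odd_double_half oi //.
Qed.

Lemma eq_rowC c c' : (forall l, (l < n)%N -> c l = c' l) -> rowC c = rowC c'.
Proof.
by move=> h; apply/rowP => i; rewrite !mxE h //; have := ltn_ord i; lia.
Qed.

Lemma dot_seqC v w :
  \sum_i v 0 i * w 0 i = \sum_(l < n) dotc (seqC v l) (seqC w l).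
Proof.
under eq_bigr do rewrite -!coord_natE.
pose F k := coord_nat v k * coord_nat w k.
rewrite -(big_mkord xpredT F).
have pairs m : \sum_(0 <= k < m.*2) F k = \sum_(l < m) (F l.*2 + F l.*2.+1).
  elim: m => [|m IH]; first by rewrite big_nil big_ord0.
  by rewrite doubleS !big_nat_recr //= IH big_ord_recr /= addrA.
have [n0|n_gt0] := posnP n.
  rewrite big_geq ?big1 // => [l _|]; last by lia.
  by have := ltn_ord l; lia.
rewrite (_ : 2 * n - 2 = n.-1.*2)%N; last by lia.
rewrite pairs -(big_mkord xpredT (fun l => F l.*2 + F l.*2.+1)).
rewrite -(big_mkord xpredT (fun l => dotc (seqC v l) (seqC w l))).
rewrite -[n in RHS](prednK n_gt0) big_nat_recl //= [X in _ = X + _]/dotc /=.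
by rewrite !mul0r !add0r.
Qed.

Lemma coord_nat_continuous k : continuous (fun v => coord_nat v k).
Proof.
rewrite /coord_nat; case: insub => [i|]; last exact: cst_continuous.
exact: coord_continuous.
Qed.

Lemma seqC_continuous l : continuous (fun v => seqC v l).
Proof.
case: l => [|l]; first exact: cst_continuous.
by apply: complex_continuous; exact: coord_nat_continuous.
Qed.

End coding.

Section cone_embedding.
Variables (R : realType) (d : nat).
Local Notation V := 'rV[R]_d.
Local Notation X := (sphere R d * sphere R d)%type.

Definition sqnorm (v : V) : R := \sum_i v 0 i ^+ 2.

Lemma sqnorm_ge0 v : 0 <= sqnorm v.
Proof. by apply: sumr_ge0 => i _; exact: sqr_ge0. Qed.

Lemma sqnormZ (r : R) v : sqnorm (r *: v) = r ^+ 2 * sqnorm v.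
Proof. by rewrite mulr_sumr; apply: eq_bigr => i _; rewrite mxE exprMn. Qed.

Lemma sqnorm_eq0 v : sqnorm v = 0 -> v = 0.
Proof.
move=> v0; apply/rowP => i; rewrite mxE; apply/eqP.
rewrite -sqrf_eq0; apply/eqP.
by apply: psumr_eq0P v0 _ _ => // j _; exact: sqr_ge0.
Qed.

Definition cone_emb_fun (b : bool) : cone_summand R X b -> V * V :=
  if b return cone_summand R X b -> V * V
  then fun xs => (\val xs.2 *: \val xs.1.1, \val xs.2 *: \val xs.1.2)
  else fun=> (0, 0).

Definition cone_emb0 : {b : bool & cone_summand R X b} -> V * V :=
  fun p => cone_emb_fun (projT2 p).

Lemma sphere1 (u : sphere R d) : sqnorm (\val u) = 1.
Proof. exact: (set_valP u). Qed.

Lemma unit_itv (s : (`[0%R, 1%R]%classic : set R)) : 0 <= \val s <= 1.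
Proof. by have := set_valP s; rewrite /= in_itv. Qed.

Lemma cone_emb0_vertex p : at_vertex p = (sqnorm (cone_emb0 p).1 == 0).
Proof.
case: p => [[] x] /=.
  case: x => [[u v] s]; rewrite /cone_emb0 /=.
  by rewrite sqnormZ sphere1 mulr1 sqrf_eq0.
rewrite /cone_emb0 /=.
by rewrite /sqnorm big1 ?eqxx // => i _; rewrite mxE expr0n.
Qed.

Lemma cone_emb0_0 p : at_vertex p -> cone_emb0 p = (0, 0).
Proof.
case: p => [[] x] //=; case: x => [[u v] s] /= /eqP s0.
by rewrite /cone_emb0 /= s0 !scale0r.
Qed.

Lemma cone_emb0P p q : cone_eq p q <-> cone_emb0 p = cone_emb0 q.
Proof.
split.
  by move=> /orP[/eqP -> //|/andP[vp vq]]; rewrite !cone_emb0_0.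
move=> pq; apply/orP.
have : at_vertex p = at_vertex q by rewrite !cone_emb0_vertex pq.
case vp : (at_vertex p) => vq; first by right; rewrite -vq.
left; case: p q pq vp vq => [[] [[u v] s]] // [[] [[u' v'] s']] //=.
rewrite /cone_emb0 /= => -[eu ev] sn0 s'n0.
have ss : \val s = \val s'.
  have := congr1 sqnorm eu; rewrite !sqnormZ !sphere1 !mulr1.
  have /andP[s0 _] := unit_itv s; have /andP[s'0 _] := unit_itv s'.
  by move/eqP; rewrite eqrXn2 // => /eqP.
rewrite ss in eu ev.
have s'0 : \val s' != 0 by rewrite -s'n0.
apply/eqP; congr existT; congr (_, _, _); apply: val_inj => //.
  exact: (scalerI s'0 eu).
exact: (scalerI s'0 ev).
Qed.

Definition cone_emb (c : cone R X) : V * V := cone_emb0 (repr c).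

Lemma cone_emb_pi p : cone_emb (\pi_(cone R X) p) = cone_emb0 p.
Proof.
apply/cone_emb0P; have /eqmodP := reprK (\pi_(cone R X) p).
exact.
Qed.

Lemma cone_emb_inj : injective cone_emb.
Proof.
move=> c c' /cone_emb0P e; rewrite -[c]reprK -[c']reprK; apply/eqmodP.
exact: e.
Qed.

Lemma cone_emb_vertex : cone_emb vertex = (0, 0).
Proof. by rewrite cone_emb_pi. Qed.

Lemma cone_emb_continuous : continuous cone_emb.
Proof.
apply/quotient_continuous.
have -> : cone_emb \o \pi_(cone R X) = cone_emb0 by apply/funext => p; exact: cone_emb_pi.
apply: sigT_continuous => -[]; last exact: cst_continuous.
have cs : continuous (fun xs : cone_summand R X true => \val xs.2).
  by move=> x; apply: continuous_comp; [exact: cvg_snd|exact: set_val_continuous].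
apply: continuous_pair => x; apply: cvgZ.
- exact: cs.
- apply: (@continuous_comp _ _ _ (fun xs : cone_summand R X true => xs.1.1));
    last exact: set_val_continuous.
  by apply: continuous_comp; [exact: cvg_fst|exact: cvg_fst].
- exact: cs.
- apply: (@continuous_comp _ _ _ (fun xs : cone_summand R X true => xs.1.2));
    last exact: set_val_continuous.
  by apply: continuous_comp; [exact: cvg_fst|exact: cvg_snd].
Qed.

Lemma cone_embP a b :
  (exists c, cone_emb c = (a, b)) <-> sqnorm a = sqnorm b /\ sqnorm b <= 1.
Proof.
split=> [[c]|[ab b1]].
  rewrite -[c]reprK cone_emb_pi; case: (repr c) => [[] x]; rewrite /cone_emb0 /=.
    move=> [<- <-]; rewrite !sqnormZ !sphere1 mulr1; split => //.
    by have /andP[s0 s1] := unit_itv x.2; rewrite expr_le1.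
  by move=> [<- <-]; split => //; rewrite /sqnorm big1 // => i _; rewrite mxE expr0n.
have [b0|bn0] := eqVneq (sqnorm b) 0.
  exists vertex; rewrite cone_emb_vertex (sqnorm_eq0 b0).
  by rewrite (@sqnorm_eq0 a) // ab.
have b_gt0 : 0 < sqnorm b by rewrite lt_neqAle eq_sym bn0 sqnorm_ge0.
pose s := Num.sqrt (sqnorm b).
have s2 : s ^+ 2 = sqnorm b by rewrite sqr_sqrtr // sqnorm_ge0.
have s_gt0 : 0 < s by rewrite sqrtr_gt0.
have sI : (`[0, 1]%classic : set R) s.
  by rewrite /= in_itv /= (ltW s_gt0) -(@expr_le1 _ 2 s) ?(ltW s_gt0) // s2.
have Sa : sphere R d (s^-1 *: a).
  by rewrite /sphere /= -/(sqnorm _) sqnormZ ab -s2 -exprMn mulVf ?expr1n // gt_eqF.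
have Sb : sphere R d (s^-1 *: b).
  by rewrite /sphere /= -/(sqnorm _) sqnormZ -s2 -exprMn mulVf ?expr1n // gt_eqF.
pose ua : sphere R d := SigSub (mem_set Sa).
pose ub : sphere R d := SigSub (mem_set Sb).
pose si : (`[0, 1]%classic : set R) := SigSub (mem_set sI).
exists (\pi_(cone R X) (existT (cone_summand R X) true (ua, ub, si))).
rewrite cone_emb_pi /cone_emb0 /=.
by rewrite !scalerA mulfV ?gt_eqF // !scale1r.
Qed.

Lemma cone_compact : compact [set: cone R X].
Proof.
have -> : [set: cone R X] = \pi_(cone R X) @` setT.
  by apply/seteqP; split => // c _; exists (repr c) => //; exact: reprK.
apply: continuous_compact.
  by apply: continuous_subspaceT; exact: pi_continuous.
apply: sigT_compact => [|[]]; first exact: finite_finset.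
  have cS : compact [set: sphere R d] by apply/compact_set_type/sphere_compact.
  have cI : compact [set: (`[0%R, 1%R]%classic : set R)].
    by apply/compact_set_type/segment_compact.
  have := compact_setX (compact_setX cS cS) cI.
  by rewrite !setXTT.
apply: finite_compact.
exact: finite_finset.
Qed.

Lemma rV2_hausdorff : hausdorff_space (V * V)%type.
Proof.
apply: (@hausdorff_separating _ R) => -[a b] [a' b'] h; congr (_, _); apply/rowP => i.
  apply: (h (fun p => p.1 0 i)) => x.
  apply: (@continuous_comp _ _ _ fst (fun a : V => a 0 i)); first exact: cvg_fst.
  exact: coord_continuous.
apply: (h (fun p => p.2 0 i)) => x.
apply: (@continuous_comp _ _ _ snd (fun a : V => a 0 i)); first exact: cvg_snd.
exact: coord_continuous.
Qed.

End cone_embedding.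

Section SU2_compact.
Variable R : realType.
Local Notation C := R[i].

Lemma SU2_compact : compact [set: SU2 R].
Proof.
pose q (v : 'rV[R]_4) := qmx (v 0 0 +i* v 0 1) (v 0 2%:R +i* v 0 3%:R).
have qS (v : sphere R 4) : SU2_set (q (\val v)).
  apply: SU2_qmx; rewrite -(sphere1 v) /sqnorm !big_ord_recr big_ord0 /= add0r /qnorm2 /=.
  by congr (_ ^+ 2 + _ ^+ 2 + _ ^+ 2 + _ ^+ 2); congr (\val v 0 _); exact: val_inj.
pose f (v : sphere R 4) : SU2 R := SigSub (mem_set (qS v)).
have -> : [set: SU2 R] = f @` setT.
  apply/seteqP; split => // A _.
  have [eA nA] := SU2_qmxP (SU2P A).
  set a := \val A 0 0 in eA nA; set b := \val A 0 1 in eA nA.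
  pose v : 'rV[R]_4 := \row_i nth 0 [:: Re a; Im a; Re b; Im b] i.
  have Sv : sphere R 4 v.
    by rewrite /sphere /= !big_ord_recr big_ord0 /= add0r !mxE /= -nA.
  exists (SigSub (mem_set Sv)) => //; apply: val_inj => /=; rewrite eA /q !mxE /=.
  by congr qmx; [case: (a)|case: (b)].
apply: (@continuous_compact _ _ f); last exact/compact_set_type/sphere_compact.
apply: continuous_subspaceT; apply: set_type_continuous.
have cv (i : 'I_4) : continuous (fun v : sphere R 4 => \val v 0 i).
  move=> v; apply: (@continuous_comp _ _ _ (fun v : sphere R 4 => \val v)
    (fun u : 'rV[R]_4 => u 0 i)).
    exact: set_val_continuous.
  exact: coord_continuous.
apply: mx_continuous => i j.
have -> : (fun v : sphere R 4 => (set_val \o f) v i j) = fun v => q (\val v) i j by [].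
under eq_fun do rewrite mxE.
case: (i == 0); case: (j == 0);
  try apply: complex_continuousN; try apply: complex_continuousJ;
  by apply: complex_continuous.
Qed.

End SU2_compact.

Section matrix_continuity.
Variables (R : realType) (S : topologicalType).
Local Notation C := R[i].
Implicit Types f g : S -> 'M[C]_2.

Lemma mx_continuousM f g :
  continuous f -> continuous g -> continuous (fun x => f x *m g x).
Proof.
move=> cf cg; apply: mx_continuous => i j.
under eq_fun do rewrite mulmx2E.
by apply: complex_continuousD; apply: complex_continuousM; exact: mx_continuous_entry.
Qed.

Lemma mx_continuousJ f : continuous f -> continuous (fun x => (f x)^t*).
Proof.
move=> cf; apply: mx_continuous => i j.
under eq_fun do rewrite !mxE.
by apply: complex_continuousJ; exact: mx_continuous_entry.
Qed.

Lemma mx_continuous_tr f : continuous f -> continuous (fun x => \tr (f x)).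
Proof.
move=> cf; under eq_fun do rewrite mxtrace2.
by apply: complex_continuousD; exact: mx_continuous_entry.
Qed.

Lemma vertex_mx_continuous (z y : S -> nat -> C) k :
  (forall l, continuous (fun x => z x l)) ->
  (forall l, continuous (fun x => y x l)) ->
  continuous (fun x => vertex_mx (z x) (y x) k).
Proof.
move=> cz cy.
have cdot (f g : S -> C) : continuous f -> continuous g ->
    continuous (fun x => dotc (f x) (g x)).
  by move=> cf cg; apply: real_continuousD; apply: real_continuousM; 
    (exact: complex_continuousRe || exact: complex_continuousIm).
have co i : continuous (fun x => odd_off (y x) i).
  apply: complex_continuous_ReIm; rewrite /odd_off.
    under eq_fun do rewrite raddf_sum.
    by apply: real_continuous_sum => l; exact: complex_continuousRe.
  under eq_fun do rewrite raddf_sum.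
  by apply: real_continuous_sum => l; exact: complex_continuousIm.
have cd i : continuous (fun x => odd_diag (z x) (y x) i).
  by apply: real_continuousN; apply: real_continuous_sum => l; exact: cdot.
have ce i : continuous (fun x => even_diag (z x) (y x) i).
  by apply: real_continuousB; [apply: real_continuousN|apply: cdot].
have c1 : continuous (fun x => (vtx (z x) (y x) k).1).
  rewrite /vtx; case: (odd k); apply: complex_continuous => //; exact: cst_continuous.
have c2 : continuous (fun x => (vtx (z x) (y x) k).2).
  by rewrite /vtx; case: (odd k) => /=; [exact: co|exact: cz].
have cn : continuous (fun x =>
    (Num.sqrt (qnorm2 (vtx (z x) (y x) k).1 (vtx (z x) (y x) k).2))^-1 : R).
  move=> x; apply: cvgV.
    by rewrite gt_eqF // sqrtr_gt0 qnorm2_vtx_gt0.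
  apply: (@continuous_comp _ _ _
    (fun x => qnorm2 (vtx (z x) (y x) k).1 (vtx (z x) (y x) k).2) Num.sqrt);
    last exact: sqrt_continuous.
  have cq : continuous (fun x => qnorm2 (vtx (z x) (y x) k).1 (vtx (z x) (y x) k).2).
    under eq_fun do rewrite qnorm2E.
    by apply: real_continuousD; apply: cdot.
  exact: cq.
have c1n := complex_continuousM (complex_continuous_real cn) c1.
have c2n := complex_continuousM (complex_continuous_real cn) c2.
apply: mx_continuous => i j.
under eq_fun do rewrite vertex_mxE mxE.
case: (i == 0); case: (j == 0).
- exact: c1n.
- exact: c2n.
- exact: (complex_continuousN (complex_continuousJ c2n)).
- exact: (complex_continuousJ c1n).
Qed.

End matrix_continuity.

(** * The bundle map *)

Section partial_products.
Variables (R : realType) (m : nat).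
Local Notation C := R[i].
Implicit Types B : 'I_m -> 'M[C]_2.

Definition partial_prod B k : 'M[C]_2 :=
  \prod_(i < k) (if insub (i : nat) is Some j then B j else 1).

Lemma partial_prod0 B : partial_prod B 0 = 1.
Proof. by rewrite /partial_prod big_ord0. Qed.

Lemma partial_prodS B (i : 'I_m) : partial_prod B i.+1 = partial_prod B i *m B i.
Proof. by rewrite /partial_prod big_ord_recr /= valK. Qed.

Lemma partial_prod_full B : partial_prod B m = \prod_(i < m) B i.
Proof. by apply: eq_bigr => i _; rewrite valK. Qed.

Lemma partial_prod_SU2 B k : (forall i, SU2_set (B i)) -> SU2_set (partial_prod B k).
Proof.
move=> hB; rewrite /partial_prod; elim/big_ind: _ => [|X Y|i _].
- exact: SU2_set1.
- exact: SU2_setM.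
- by case: insubP => [j _ _|_]; [exact: hB|exact: SU2_set1].
Qed.

Lemma partial_prod_conj (p : nat -> 'M[C]_2) (g : 'M[C]_2) k :
  SU2_set g -> (forall l, SU2_set (p l)) -> p 0%N = 1 -> (k <= m)%N ->
  partial_prod (fun i : 'I_m => g *m (p i)^t* *m p i.+1 *m g^t*) k =
  g *m p k *m g^t*.
Proof.
move=> [/unitarymxP ug _] hp p0; elim: k => [|k IH] km.
  by rewrite partial_prod0 p0 mulmx1 ug.
rewrite (partial_prodS _ (Ordinal km)) IH ?(ltnW km) //=.
have /unitarymxP up := (hp k).1.
rewrite !mulmxA -[_ *m g^t* *m g]mulmxA (mulmx1C ug) mulmx1.
by rewrite -[g *m p k *m _]mulmxA up mulmx1.
Qed.

End partial_products.

Section polygon_space.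
Variables (R : realType) (n : nat).
Local Notation C := R[i].
Local Notation V := 'rV[R]_(2 * n - 2).
Local Notation Cone := (cone R (sphere R (2 * n - 2) * sphere R (2 * n - 2))%type).
Implicit Types (g : SU2 R) (c : Cone) (e : V * V) (t : torus R).

(* Large enough for the image to contain all polygons whose vertices are at     *)
(* distance less than pi/3 from 1 and J alternately.                            *)
Definition cone_scale : R := 4 * n%:R.

Definition zseq e l : C := cone_scale%:C * (seqC e.1 l + seqC e.2 l).
Definition yseq e l : C := cone_scale%:C * (seqC e.1 l - seqC e.2 l).

Lemma zseq0 e : zseq e 0 = 0. Proof. by rewrite /zseq /= addr0 mulr0. Qed.
Lemma yseq0 e : yseq e 0 = 0. Proof. by rewrite /yseq /= subr0 mulr0. Qed.
Lemma zseqn e : zseq e n = 0.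
Proof. by rewrite /zseq !seqC_out // addr0 mulr0. Qed.
Lemma yseqn e : yseq e n = 0.
Proof. by rewrite /yseq !seqC_out // subr0 mulr0. Qed.

Lemma sum_zseq_yseq e :
  \sum_(l < n) dotc (zseq e l) (yseq e l) = cone_scale ^+ 2 * (sqnorm e.1 - sqnorm e.2).
Proof.
rewrite /sqnorm !(eq_bigr _ (fun i _ => expr2 _)) !dot_seqC -sumrB mulr_sumr.
apply: eq_bigr => l _; rewrite /zseq /yseq /dotc.
by case: (seqC e.1 l) (seqC e.2 l) => [? ?] [? ?] /=; ring.
Qed.

Definition corner e k := vertex_mx (zseq e) (yseq e) k.

Definition edges g e : 'I_(2 * n) -> 'M[C]_2 :=
  fun i => \val g *m (corner e i)^t* *m corner e i.+1 *m (\val g)^t*.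

Lemma corner0 e : corner e 0 = 1.
Proof. by rewrite /corner vertex_mx0 ?zseq0 ?yseq0. Qed.

Lemma corner1 e : corner e 1 = Jmx R.
Proof. by rewrite /corner vertex_mx1 ?zseq0 ?yseq0. Qed.

Lemma corner_last e : sqnorm e.1 = sqnorm e.2 -> corner e (2 * n) = 1.
Proof.
move=> h; rewrite /corner vertex_mx_last ?zseqn ?yseqn //.
by rewrite sum_zseq_yseq h subrr mulr0.
Qed.

Lemma partial_prod_edges g e k : (k <= 2 * n)%N ->
  partial_prod (edges g e) k = \val g *m corner e k *m (\val g)^t*.
Proof.
apply: (partial_prod_conj (p := corner e)); last exact: corner0.
  exact: SU2P.
by move=> l; exact: vertex_mx_SU2.
Qed.

Lemma mxtrace_conjSU2 g (A : 'M[C]_2) : \tr (\val g *m A *m (\val g)^t*) = \tr A.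
Proof.
have [/unitarymxP ug _] := SU2P g.
by rewrite mxtrace_mulC mulmxA (mulmx1C ug) mul1mx.
Qed.

Lemma edges_K g e : sqnorm e.1 = sqnorm e.2 -> @K_set R (2 * n) (edges g e).
Proof.
move=> he; split=> [i|].
  split; last first.
    by rewrite /edges -[_ *m _ *m corner _ _]mulmxA mxtrace_conjSU2 vertex_mx_orth.
  apply: SU2_setM; last exact/SU2_setV/SU2P.
  apply: SU2_setM; last exact: vertex_mx_SU2.
  by apply: SU2_setM; [exact: SU2P|exact/SU2_setV/vertex_mx_SU2].
rewrite -partial_prod_full partial_prod_edges // corner_last // mulmx1.
by have [/unitarymxP ug _] := SU2P g.
Qed.

Lemma cone_emb_eq c : sqnorm (cone_emb c).1 = sqnorm (cone_emb c).2.
Proof.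
have /cone_embP[] // : exists c', cone_emb c' = ((cone_emb c).1, (cone_emb c).2).
by exists c; case: cone_emb.
Qed.

Definition polygon g c : K R (2 * n) :=
  SigSub (mem_set (edges_K g (cone_emb_eq c))).

Lemma polygon_continuous : continuous (fun p : SU2 R * Cone => polygon p.1 p.2).
Proof.
apply: set_type_continuous; apply: ptws_continuous => i.
have cg : continuous (fun p : SU2 R * Cone => \val p.1).
  exact: (continuous_compose (@continuous_fst _ Cone) (@set_val_continuous _ (@SU2_set R))).
have cemb : continuous (fun p : SU2 R * Cone => cone_emb p.2).
  exact: (continuous_compose (@continuous_snd (SU2 R) Cone) (@cone_emb_continuous _ _)).
have c1 l : continuous (fun p : SU2 R * Cone => seqC (cone_emb p.2).1 l).
  exact: (continuous_compose (continuous_compose cemb (@continuous_fst _ _))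
    (@seqC_continuous _ _ l)).
have c2 l : continuous (fun p : SU2 R * Cone => seqC (cone_emb p.2).2 l).
  exact: (continuous_compose (continuous_compose cemb (@continuous_snd _ _))
    (@seqC_continuous _ _ l)).
have cs : continuous (fun _ : SU2 R * Cone => cone_scale%:C) by exact: cst_continuous.
have cc k : continuous (fun p : SU2 R * Cone => corner (cone_emb p.2) k).
  apply: vertex_mx_continuous => l.
    exact: (complex_continuousM cs (complex_continuousD (c1 l) (c2 l))).
  exact: (complex_continuousM cs (complex_continuousD (c1 l) (complex_continuousN (c2 l)))).
exact: (mx_continuousM (mx_continuousM (mx_continuousM cg (mx_continuousJ (cc i)))
  (cc i.+1)) (mx_continuousJ cg)).
Qed.

End polygon_space.

Section torus_on_cone.
Variables (R : realType) (n : nat).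
Local Notation C := R[i].
Local Notation V := 'rV[R]_(2 * n - 2).
Local Notation Cone := (cone R (sphere R (2 * n - 2) * sphere R (2 * n - 2))%type).
Implicit Types (g : SU2 R) (c : Cone) (e : V * V) (s t : torus R).

Definition rotV (w : C) (v : V) : V := rowC n (fun l => w * seqC v l).

Lemma seqC_rotV w v l : seqC (rotV w v) l = w * seqC v l.
Proof.
rewrite seqC_rowC //= ?mulr0 // => k nk; by rewrite seqC_out // mulr0.
Qed.

Lemma rotV1 v : rotV 1 v = v.
Proof. by rewrite -[RHS]seqCK; apply: eq_rowC => l _; rewrite mul1r. Qed.

Lemma rotVM w w' v : rotV (w * w') v = rotV w (rotV w' v).
Proof. by apply: eq_rowC => l _; rewrite seqC_rotV mulrA. Qed.

Lemma sqnorm_rotV w v : dotc w w = 1 -> sqnorm (rotV w v) = sqnorm v.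
Proof.
move=> w1; rewrite /sqnorm !(eq_bigr _ (fun i _ => expr2 _)) !dot_seqC.
by apply: eq_bigr => l _; rewrite !seqC_rotV dotcMM w1 mul1r.
Qed.

Lemma rotV0 w : rotV w 0 = 0.
Proof.
apply/rowP => i; rewrite !mxE /= -(subrr (0 : V)) !coord_natD !coord_natN.
by rewrite !subrr complexr0 mulr0 /= if_same.
Qed.

Definition phase t : C := (\val (\val t)) 0 0.

Lemma torus_qmx t : \val (\val t) = qmx (phase t) 0.
Proof.
have [-> _] := SU2_qmxP (SU2P (\val t)).
rewrite -[in RHS]/(phase t); congr qmx; rewrite ?mxE //.
by have /is_diag_mxP := set_valP t; apply.
Qed.

Lemma phase_norm t : dotc (phase t) (phase t) = 1.
Proof.
have [_] := SU2_qmxP (SU2P (\val t)).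
rewrite torus_qmx !mxE /= qnorm2E => <-; by rewrite /dotc /= mulr0 !addr0.
Qed.

Lemma phase2_norm t : dotc (phase t ^+ 2) (phase t ^+ 2) = 1.
Proof. by rewrite expr2 dotcMM phase_norm mul1r. Qed.

Lemma phase1 : phase 1%g = 1.
Proof. by rewrite /phase /= mxE eqxx. Qed.

Lemma phaseM s t : phase (s * t)%g = phase s * phase t.
Proof.
have -> : phase (s * t)%g = (\val (\val s) *m \val (\val t)) 0 0 by [].
by rewrite !torus_qmx qmxM mxE /= mul0r subr0.
Qed.

Lemma phase_continuous : continuous phase.
Proof.
have h := continuous_compose
  (@set_val_continuous _ (@torus_set R)) (@set_val_continuous _ (@SU2_set R)).
exact: (mx_continuous_entry (i := 0) (j := 0) h).
Qed.

Definition rot2 (w : C) e : V * V := (rotV w e.1, rotV w e.2).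

(* Transporting the linear action along the embedding of the compact cone gives *)
(* joint continuity, which is not automatic for a quotient times the torus.     *)
Definition cone_act t c : Cone :=
  xget vertex [set c' | cone_emb c' = rot2 (phase t ^+ 2) (cone_emb c)].

Lemma cone_emb_act t c : cone_emb (cone_act t c) = rot2 (phase t ^+ 2) (cone_emb c).
Proof.
apply: (@xgetPex _ vertex [set c' | cone_emb c' = rot2 (phase t ^+ 2) (cone_emb c)]).
have /cone_embP[h1 h2] : exists c', cone_emb c' = ((cone_emb c).1, (cone_emb c).2).
  by exists c; case: cone_emb.
by apply/cone_embP; rewrite !sqnorm_rotV ?phase2_norm.
Qed.

Lemma cone_act1 c : cone_act 1%g c = c.
Proof.
apply: cone_emb_inj; rewrite cone_emb_act phase1 expr1n /rot2 !rotV1.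
by case: cone_emb.
Qed.

Lemma cone_actM s t c : cone_act (s * t)%g c = cone_act s (cone_act t c).
Proof.
by apply: cone_emb_inj; rewrite !cone_emb_act phaseM exprMn /rot2 /= !rotVM.
Qed.

Lemma cone_act_continuous : continuous (fun p : torus R * Cone => cone_act p.1 p.2).
Proof.
apply: (compact_lift_continuous (@cone_compact _ _) (@rV2_hausdorff R (2 * n - 2))
  (@cone_emb_continuous _ _) (@cone_emb_inj _ _)).
have -> : @cone_emb _ _ \o (fun p : torus R * Cone => cone_act p.1 p.2) =
    fun p => rot2 (phase p.1 ^+ 2) (cone_emb p.2).
  by apply/funext => p; exact: cone_emb_act.
have cp : continuous (fun p : torus R * Cone => phase p.1 ^+ 2).
  have h := continuous_compose (@continuous_fst _ Cone) phase_continuous.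
  exact: (complex_continuousM h h).
have cemb : continuous (fun p : torus R * Cone => cone_emb p.2).
  exact: (continuous_compose (@continuous_snd (torus R) Cone) (@cone_emb_continuous _ _)).
have crot (f : torus R * Cone -> V) : continuous f ->
    continuous (fun p => rotV (phase p.1 ^+ 2) (f p)).
  move=> cf; apply: mx_continuous => i j.
  have cl l := complex_continuousM cp (continuous_compose cf (@seqC_continuous _ _ l)).
  under eq_fun do rewrite mxE.
  case: (odd j).
    exact: (complex_continuousIm (cl _)).
  exact: (complex_continuousRe (cl _)).
apply: continuous_pair; apply: crot.
  exact: (continuous_compose cemb (@continuous_fst _ _)).
exact: (continuous_compose cemb (@continuous_snd _ _)).
Qed.

Definition cone_action : torus_action R Cone :=
  TorusAction cone_act1 cone_actM cone_act_continuous.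

Lemma cone_act_vertex t : cone_act t vertex = vertex.
Proof.
by apply: cone_emb_inj; rewrite cone_emb_act cone_emb_vertex /rot2 /= !rotV0.
Qed.

Lemma zseq_rot w e : zseq (rot2 w e) = fun l => w * zseq e l.
Proof. by apply/funext => l; rewrite /zseq /= !seqC_rotV -mulrDr mulrCA. Qed.

Lemma yseq_rot w e : yseq (rot2 w e) = fun l => w * yseq e l.
Proof. by apply/funext => l; rewrite /yseq /= !seqC_rotV -mulrBr mulrCA. Qed.

Lemma corner_act t c k : corner (cone_emb (cone_act t c)) k =
  \val (\val t) *m corner (cone_emb c) k *m (\val (\val t))^t*.
Proof.
rewrite torus_qmx /corner -vertex_mx_rot ?phase_norm // cone_emb_act.
by rewrite zseq_rot yseq_rot.
Qed.

Lemma trmxCM (A B : 'M[C]_2) : (A *m B)^t* = B^t* *m A^t*.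
Proof. by rewrite trmx_mul map_mxM. Qed.

Lemma trmxCKC (A : 'M[C]_2) : (A^t*)^t* = A.
Proof. exact: trmxCK. Qed.

Lemma edges_act (a b g t : 'M[C]_2) : SU2_set t ->
  (g *m t) *m a^t* *m b *m (g *m t)^t* =
  g *m (t *m a *m t^t*)^t* *m (t *m b *m t^t*) *m g^t*.
Proof.
move=> [/unitarymxP ut _]; rewrite !trmxCM trmxCKC !mulmxA.
by rewrite -[_ *m t^t* *m t]mulmxA (mulmx1C ut) mulmx1.
Qed.

Lemma polygon_act g t c : polygon (g * \val t)%g c = polygon g (cone_act t c).
Proof.
apply: val_inj; apply/funext => i; rewrite /= /edges !corner_act.
exact/edges_act/SU2P.
Qed.

Definition bundle_polygon (q : bundle cone_action) : K R (2 * n) :=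
  polygon (repr q).1 (repr q).2.

Lemma bundle_polygon_pi g c :
  bundle_polygon (\pi_(bundle cone_action) (g, c)) = polygon g c.
Proof.
rewrite /bundle_polygon.
have /eqmodP/asboolP[t] := reprK (\pi_(bundle cone_action) (g, c)).
by case: (repr _) => g' c' /= [-> ->]; exact: polygon_act.
Qed.

Lemma bundle_polygon_continuous : continuous bundle_polygon.
Proof.
apply/quotient_continuous.
have -> : bundle_polygon \o \pi_(bundle cone_action) = fun p => polygon p.1 p.2.
  by apply/funext => -[g c]; exact: bundle_polygon_pi.
exact: polygon_continuous.
Qed.

Lemma bundle_compact : compact [set: bundle cone_action].
Proof.
have -> : [set: bundle cone_action] = \pi_(bundle cone_action) @` setT.
  by apply/seteqP; split => // c _; exists (repr c) => //; exact: reprK.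
apply: continuous_compact.
  by apply: continuous_subspaceT; exact: pi_continuous.
by rewrite -setXTT; apply: compact_setX; [exact: SU2_compact|exact: cone_compact].
Qed.

End torus_on_cone.

Section SU2_conjugation.
Variable R : realType.
Local Notation C := R[i].

Lemma SU2_mulJ (A : 'M[C]_2) : SU2_set A -> A *m A^t* = 1%:M /\ A^t* *m A = 1%:M.
Proof. by move=> [/unitarymxP uA _]; split => //; exact: mulmx1C. Qed.

Lemma J_adj : (Jmx R)^t* = - Jmx R.
Proof.
by rewrite /Jmx qmxJ; apply: mx2P; rewrite !mxE /=; complex_ring.
Qed.

Lemma commute_J_diag (A : 'M[C]_2) : SU2_set A -> A *m Jmx R = Jmx R *m A ->
  is_diag_mx A.
Proof.
move=> SA; have [-> _] := SU2_qmxP SA; move: (A 0 0) (A 0 1) => a b.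
rewrite /Jmx !qmxM => /qmx_inj[_]; case: a b => a1 a2 [b1 b2] e.
have b0 : b1 +i* b2 = 0.
  move: e => /eqP; rewrite eq_complex /= => /andP[/eqP e1 /eqP e2].
  by apply/eqP; rewrite eq_complex /=; apply/andP; split; apply/eqP; move: e1 e2; lra.
rewrite b0; apply/is_diag_mxP => i j; rewrite !mxE.
case: i => [[|[|//]]] ?; case: j => [[|[|//]]] ? //= _.
by rewrite rmorph0 oppr0.
Qed.

Lemma J_transitive (A : 'M[C]_2) : traceless A ->
  exists g : SU2 R, A = \val g *m Jmx R *m (\val g)^t*.
Proof.
(* Up to normalisation g = 1 - A J, which only vanishes for A = - J. *)
move=> [SA trA].
suff [k [G [k0 nG AG]]] : exists k : R, exists G : C * C,
    [/\ 0 < k, qnorm2 G.1 G.2 = k & A *m qmx G.1 G.2 = qmx G.1 G.2 *m Jmx R].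
  pose c := (Num.sqrt k)^-1.
  have c2 : c ^+ 2 * k = 1 by rewrite exprVn sqr_sqrtr ?ltW // mulVf // gt_eqF.
  have Sg : SU2_set (qmx (c%:C * G.1) (c%:C * G.2)).
    by apply: SU2_qmx; rewrite qnorm2Z nG.
  exists (SigSub (mem_set Sg)) => /=.
  rewrite -qmxZ in Sg *; have [gg _] := SU2_mulJ Sg.
  by rewrite -[LHS]mulmx1 -gg mulmxA -scalemxAr AG scalemxAl.
have [eA nA] := SU2_qmxP SA; move: trA; rewrite {1}eA qmx_tr => /complexI /eqP.
rewrite mulrn_eq0 /= => /eqP.
move: eA nA; move: (A 0 0) (A 0 1) => [a1 a] [b1 b2] -> /=; rewrite /qnorm2 /= => nA.
move=> a10; subst a1; have [aN|aN] := eqVneq a (-1).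
  have : b1 ^+ 2 + b2 ^+ 2 = 0 by move: nA; rewrite aN; lra.
  move/eqP; rewrite paddr_eq0 ?sqr_ge0 // !sqrf_eq0 => /andP[/eqP b10 /eqP b20].
  exists 1, (0, 1); split => //; first by rewrite /qnorm2 /=; ring.
  by rewrite /Jmx !qmxM b10 b20 aN; congr qmx; complex_ring.
exists (2 + 2 * a), ((1 + a)%:C, (- b2) +i* b1); split => /=.
- suff : -1 < a by lra.
  by rewrite lt_neqAle eq_sym aN /=; nra.
- by rewrite /qnorm2 /=; move: nA; nra.
- rewrite /Jmx !qmxM; congr qmx; apply/eqP; rewrite eq_complex /=; apply/andP; split;
    apply/eqP; try ring.
  by move: nA; nra.
Qed.

End SU2_conjugation.

Section tubular.
Variables (R : realType) (n : nat).
Hypothesis n_gt0 : (0 < n)%N.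
Local Notation C := R[i].
Local Notation V := 'rV[R]_(2 * n - 2).
Local Notation Cone := (cone R (sphere R (2 * n - 2) * sphere R (2 * n - 2))%type).
Implicit Types (g : SU2 R) (c : Cone) (e : V * V) (t : torus R).

Lemma cone_scale_gt0 : 0 < cone_scale R n.
Proof. by rewrite mulr_gt0 // ltr0n. Qed.

Lemma cone_scaleC_neq0 : (cone_scale R n)%:C != 0 :> C.
Proof. by rewrite eq_complex /= eqxx andbT gt_eqF // cone_scale_gt0. Qed.

Lemma zyseq_inj e e' : (forall l, (l < n)%N ->
  zseq e l = zseq e' l /\ yseq e l = yseq e' l) -> e = e'.
Proof.
move=> h; case: e e' h => [a b] [a' b'] h.
suff ab l : (l < n)%N -> seqC a l = seqC a' l /\ seqC b l = seqC b' l.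
  congr (_, _); rewrite -[LHS]seqCK -[RHS]seqCK; apply: eq_rowC => l ln;
    by have [] := ab l ln.
move=> /h[]; rewrite /zseq /yseq /= 
  => /(mulfI cone_scaleC_neq0) e1 /(mulfI cone_scaleC_neq0) e2.
have two : (2 : C) != 0 by rewrite pnatr_eq0.
split; apply: (mulfI two).
  have -> : 2 * seqC a l = (seqC a l + seqC b l) + (seqC a l - seqC b l) by ring.
  by rewrite e1 e2; ring.
have -> : 2 * seqC b l = (seqC a l + seqC b l) - (seqC a l - seqC b l) by ring.
by rewrite e1 e2; ring.
Qed.

Lemma conjSU2_inj g (A B : 'M[C]_2) :
  \val g *m A *m (\val g)^t* = \val g *m B *m (\val g)^t* -> A = B.
Proof.
have [_ gg] := SU2_mulJ (SU2P g).
move=> h; have := congr1 (fun X => (\val g)^t* *m X *m \val g) h => /=.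
by rewrite !mulmxA gg !mul1mx -!mulmxA gg !mulmx1.
Qed.

Lemma edges_inj g e e' : edges g e = edges g e' -> e = e'.
Proof.
move=> he; apply: zyseq_inj; apply: vertex_mx_inj => k kn.
have e1 := partial_prod_edges g e (ltnW kn).
have e2 := partial_prod_edges g e' (ltnW kn).
rewrite he in e1; exact: (conjSU2_inj (etrans (esym e1) e2)).
Qed.

Lemma polygon_inj g g' c c' : polygon g c = polygon g' c' ->
  exists t : torus R, g = (g' * \val t)%g /\ c' = cone_act t c.
Proof.
move=> h; have he : edges g (cone_emb c) = edges g' (cone_emb c').
  exact: (congr1 val h).
have n1 : (1 <= 2 * n)%N by lia.
have := partial_prod_edges g (cone_emb c) n1.
rewrite he partial_prod_edges // !corner1 => gJ.
have [_ gg] := SU2_mulJ (SU2P g); have [_ g'g'] := SU2_mulJ (SU2P g').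
have dt : torus_set (g'^-1 * g)%g.
  apply: commute_J_diag; first exact: SU2P.
  have := congr1 (fun X => (\val g')^t* *m X *m \val g) gJ => /=.
  rewrite !mulmxA g'g' mul1mx -!mulmxA gg mulmx1 => <-.
  by rewrite mulmxA.
exists (SigSub (mem_set dt)); set t := SigSub _.
have gt : g = (g' * \val t)%g by rewrite /= mulgA mulgV mul1g.
split=> //; apply: cone_emb_inj; apply/esym/(@edges_inj g').
by rewrite gt polygon_act in h; exact: (congr1 val h).
Qed.

Lemma seqC0 l : seqC (0 : V) l = 0.
Proof. by rewrite -(subrr (0 : V)) seqCD seqCN subrr. Qed.

Lemma corner_vertex k :
  corner (cone_emb (vertex : Cone)) k = if odd k then Jmx R else 1.
Proof.
rewrite cone_emb_vertex /corner.
have z0 : zseq ((0, 0) : V * V) = fun=> 0.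
  by apply/funext => l; rewrite /zseq /= !seqC0 addr0 mulr0.
have y0 : yseq ((0, 0) : V * V) = fun=> 0.
  by apply/funext => l; rewrite /yseq /= !seqC0 subr0 mulr0.
have d0 : dotc (0 : C) 0 = 0 by rewrite /dotc /= mulr0 addr0.
rewrite z0 y0 vertex_mxE.
have -> : vtx (fun=> 0 : C) (fun=> 0) k = if odd k then ('i, 0) else (1, 0).
  rewrite /vtx /even_diag /odd_diag /odd_off.
  have s0 i : \sum_(l < i) dotc (0 : C) 0 = 0 by apply: big1 => l _; exact: d0.
  by rewrite !s0 !big1 // d0 !oppr0 addr0; case: (odd k).
by case: (odd k); rewrite /qnorm2 /= expr1n !expr0n /= ?addr0 ?add0r sqrtr1 invr1
  !mul1r ?qmx1.
Qed.

Lemma edges_vertex g (i : 'I_(2 * n)) : edges g (cone_emb (vertex : Cone)) i =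
  if odd i then - (\val g *m Jmx R *m (\val g)^t*) else \val g *m Jmx R *m (\val g)^t*.
Proof.
have e1 : (1 : 'M[C]_2)^t* = 1 by rewrite trmx1 map_mx1.
rewrite /edges !corner_vertex /=; case: (odd i) => /=.
  by rewrite J_adj mulmx1 mulmxN mulNmx.
by rewrite e1 mulmx1.
Qed.

Lemma conjJ_traceless g : traceless (\val g *m Jmx R *m (\val g)^t*).
Proof.
split; last by rewrite mxtrace_conjSU2 /Jmx qmx_tr mul0rn.
apply: SU2_setM; last exact/SU2_setV/SU2P.
apply: SU2_setM; first exact: SU2P.
by apply: SU2_qmx; rewrite /qnorm2 /= !expr0n expr1n /= !addr0 add0r.
Qed.

Lemma polygon_vertex_Delta :
  [set polygon g (vertex : Cone) | g in [set: SU2 R]] = Delta R (2 * n).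
Proof.
apply/seteqP; split=> [_ [g _ <-]|B [A /J_transitive[g ->] BA]].
  by eexists; [exact: (conjJ_traceless g)|move=> i; exact: edges_vertex].
exists g => //; apply: val_inj; apply/funext => i.
by rewrite BA; exact: edges_vertex.
Qed.

End tubular.

(** * The neighbourhood *)

Section neighbourhood.
Variables (R : realType) (n : nat).
Hypothesis n_gt0 : (0 < n)%N.
Local Notation C := R[i].
Local Notation V := 'rV[R]_(2 * n - 2).
Local Notation Cone := (cone R (sphere R (2 * n - 2) * sphere R (2 * n - 2))%type).
Implicit Types (g : SU2 R) (c : Cone) (e : V * V) (B : K R (2 * n)).

Lemma dotcZ (k : R) (a : C) : dotc (k%:C * a) (k%:C * a) = k ^+ 2 * dotc a a.
Proof. by rewrite dotcMM /dotc /= mulr0 addr0 expr2. Qed.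

Lemma dotcD_le (a b : C) (r s : R) : dotc a a <= r -> dotc b b <= s ->
  dotc (a + b) (a + b) <= 2 * (r + s).
Proof.
by case: a b => [a1 a2] [b1 b2]; rewrite /dotc /= => ha hb;
  have := sqr_ge0 (a1 - b1); have := sqr_ge0 (a2 - b2); nra.
Qed.

Lemma dotcN (a : C) : dotc (- a) (- a) = dotc a a.
Proof. by case: a => a1 a2; rewrite /dotc /=; ring. Qed.

Lemma dotc_invZ_le (r : R) (b : C) : 2^-1 < r -> dotc b b <= 1 ->
  dotc ((r^-1)%:C * b) ((r^-1)%:C * b) <= 4.
Proof.
move=> r2 b1; rewrite dotcZ.
have r0 : 0 < r by apply: lt_trans r2; rewrite invr_gt0.
have h1 : 0 < r^-1 by rewrite invr_gt0.
have h2 : r^-1 < 2 by rewrite -[ltRHS]invrK ltf_pV2 ?posrE ?invr_gt0.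
have := dotc_ge0 b; nra.
Qed.

Lemma zyseq_surj (z y : nat -> C) :
  z 0%N = 0 -> y 0%N = 0 ->
  (forall l, (n <= l)%N -> z l = 0) -> (forall l, (n <= l)%N -> y l = 0) ->
  \sum_(l < n) dotc (z l) (y l) = 0 ->
  (forall l, (l < n)%N -> dotc (z l) (z l) <= 4) ->
  (forall l, (l < n)%N -> dotc (y l) (y l) <= 16) ->
  exists c : Cone, zseq (cone_emb c) = z /\ yseq (cone_emb c) = y.
Proof.
move=> z0 y0 zn yn zy0 z4 y16; pose k : R := (2 * cone_scale R n)^-1.
have sk : cone_scale R n * k = 2^-1.
  by rewrite /k invfM mulrCA mulfV ?mulr1 // gt_eqF // cone_scale_gt0.
pose a := rowC n (fun l => k%:C * (z l + y l)).
pose b := rowC n (fun l => k%:C * (z l - y l)).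
have aE l : seqC a l = k%:C * (z l + y l).
  by rewrite seqC_rowC ?z0 ?y0 ?addr0 ?mulr0 // => j nj; rewrite zn // yn // addr0 mulr0.
have bE l : seqC b l = k%:C * (z l - y l).
  by rewrite seqC_rowC ?z0 ?y0 ?subr0 ?mulr0 // => j nj; rewrite zn // yn // subr0 mulr0.
have half (u : C) : (2^-1 : R)%:C * (u + u) = u.
  by case: u => u1 u2; apply/eqP; rewrite eq_complex /=; apply/andP; split;
    apply/eqP; field.
have zE : zseq (a, b) = z.
  apply/funext => l; rewrite /zseq /= aE bE -mulrDr mulrA -rmorphM /= sk -[RHS]half.
  by congr (_ * _); ring.
have yE : yseq (a, b) = y.
  apply/funext => l; rewrite /yseq /= aE bE -mulrBr mulrA -rmorphM /= sk -[RHS]half.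
  by congr (_ * _); ring.
have ab : sqnorm a = sqnorm b.
  have := sum_zseq_yseq (a, b); rewrite zE yE zy0 /= => /esym/eqP.
  by rewrite mulf_eq0 sqrf_eq0 gt_eqF ?cone_scale_gt0 //= subr_eq0 => /eqP.
have b1 : sqnorm b <= 1.
  rewrite /sqnorm (eq_bigr _ (fun i _ => expr2 _)) dot_seqC.
  have n1 : (1 : R) <= n%:R by rewrite ler1n.
  apply: (@le_trans _ _ (\sum_(l < n) n%:R^-1)); last first.
    by rewrite sumr_const card_ord -[leLHS]mulr_natr mulVf // pnatr_eq0 -lt0n.
  apply: ler_sum => l _; rewrite bE dotcZ.
  have hz := z4 _ (ltn_ord l); have hy := y16 _ (ltn_ord l).
  rewrite -dotcN in hy; have := dotcD_le hz hy; have := dotc_ge0 (z l - y l).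
  rewrite /k /cone_scale; set x := n%:R^-1.
  have -> : (2 * (4 * n%:R))^-1 = x / 8 :> R by rewrite /x; field; rewrite pnatr_eq0 -lt0n.
  have x0 : 0 < x by rewrite invr_gt0 ltr0n.
  have x1 : x <= 1 by rewrite invf_le1 // ltr0n.
  move: (dotc _ _) => D D0 D40; nra.
have [c cE] := (cone_embP a b).2 (conj ab b1).
by exists c; rewrite cE.
Qed.

Lemma conj_ratio (G P B : 'M[C]_2) : SU2_set G -> SU2_set P ->
  (G^t* *m P *m G)^t* *m (G^t* *m (P *m B) *m G) = G^t* *m B *m G.
Proof.
move=> /SU2_mulJ[GG _] /SU2_mulJ[_ PP]; rewrite !trmxCM trmxCKC !mulmxA.
by rewrite -[_ *m G *m G^t*]mulmxA GG mulmx1 -[_ *m P^t* *m P]mulmxA PP mulmx1.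
Qed.

Lemma corner_surj (M : nat -> 'M[C]_2) :
  (forall k, SU2_set (M k)) -> M 0%N = 1 -> M 1%N = Jmx R -> M (2 * n)%N = 1 ->
  (forall k, (k < 2 * n)%N -> \tr ((M k)^t* *m M k.+1) = 0) ->
  (forall k, (k < n)%N -> 1 < Re (\tr (M k.*2))) ->
  (forall k, (k < n)%N -> 1 < Re (\tr ((Jmx R)^t* *m M k.*2.+1))) ->
  exists c : Cone, forall k, (k <= 2 * n)%N -> corner (cone_emb c) k = M k.
Proof.
move=> SM M0 M1 Mn trM hE hO.
have [p Mq p1] : exists2 p : nat -> C * C, forall k, M k = qmx (p k).1 (p k).2 &
    forall k, qnorm2 (p k).1 (p k).2 = 1.
  by exists (fun k => (M k 0 0, M k 0 1)) => k; have [] := SU2_qmxP (SM k).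
have eqp k a b : M k = qmx a b -> p k = (a, b).
  by rewrite Mq => /qmx_inj[]; case: (p k) => ? ? /= -> ->.
have p0 : p 0%N = (1, 0) by apply: eqp; rewrite M0 qmx1.
have pJ : p 1%N = ('i, 0) by apply: eqp; rewrite M1.
have pn : p (2 * n)%N = (1, 0) by apply: eqp; rewrite Mn qmx1.
have orth k : (k < 2 * n)%N -> dotc (p k).1 (p k.+1).1 + dotc (p k).2 (p k.+1).2 = 0.
  move=> /trM; rewrite !Mq mxtraceJ_qmx => /(@complexI R)/eqP.
  by rewrite mulrn_eq0 /= => /eqP.
have reP k : (k < n)%N -> 2^-1 < Re (p k.*2).1.
  by move=> /hE; rewrite Mq qmx_tr /= mulr2n; lra.
have imP k : (k < n)%N -> 2^-1 < Im (p k.*2.+1).1.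
  by move=> /hO; rewrite Mq mxtraceJ_qmx /= mulr2n /dotc /=; lra.
have re0 k : (k < n)%N -> 0 < Re (p k.*2).1 by move=> /reP; lra.
have im0 k : (k < n)%N -> 0 < Im (p k.*2.+1).1 by move=> /imP; lra.
have b1 k : dotc (p k).2 (p k).2 <= 1.
  by rewrite -(p1 k) qnorm2E lerDr dotc_ge0.
have [z [zE zout]] : exists z : nat -> C,
    (forall l, (l < n)%N -> z l = ((Re (p l.*2).1)^-1)%:C * (p l.*2).2) /\
    (forall l, (n <= l)%N -> z l = 0).
  exists (fun l => if (l < n)%N then ((Re (p l.*2).1)^-1)%:C * (p l.*2).2 else 0).
  by split=> l; [move=> -> | rewrite leqNgt; case: ltnP].
have [w wE] : exists w : nat -> C,
    forall l, w l = ((Im (p l.*2.+1).1)^-1)%:C * (p l.*2.+1).2.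
  by eexists.
have [y [y0 yS yout]] : exists y : nat -> C, [/\ y 0%N = 0,
    forall l, (l.+1 < n)%N -> y l.+1 = w l.+1 - w l &
    forall l, (n <= l)%N -> y l = 0].
  exists (fun l => if l is l'.+1 then (if (l < n)%N then w l - w l' else 0) else 0).
  split=> // [l -> //|[//|l]]; by rewrite leqNgt; case: ltnP.
have z0 : z 0%N = 0 by rewrite zE // p0 mulr0.
have w0 : w 0%N = 0 by rewrite wE pJ mulr0.
have off_y l : (l < n)%N -> odd_off y l = w l.
  elim: l => [|l IH] ln; first by rewrite /odd_off big_ord_recl big_ord0 addr0 w0.
  by rewrite odd_offS IH ?(ltnW ln) // yS // addrC subrK.
have off_yE l : (l < n)%N ->
    odd_off y l = ((Im (p l.*2.+1).1)^-1)%:C * (p l.*2.+1).2.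
  by move=> ln; rewrite off_y // wE.
have [vE zy0] := @vertex_mx_surj R n p z y (fun k _ => p1 k) orth p0 pJ pn
  re0 im0 zE off_yE.
have w4 l : (l < n)%N -> dotc (w l) (w l) <= 4.
  by move=> ln; rewrite wE; apply: dotc_invZ_le; [exact: imP|exact: b1].
have z4 l : (l < n)%N -> dotc (z l) (z l) <= 4.
  by move=> ln; rewrite zE //; apply: dotc_invZ_le; [exact: reP|exact: b1].
have y16 l : (l < n)%N -> dotc (y l) (y l) <= 16.
  case: l => [|l] ln; first by rewrite y0 /dotc /= mulr0 addr0.
  have h := w4 _ ln; have h' := w4 _ (ltnW ln); rewrite -dotcN in h'.
  by rewrite yS //; apply: le_trans (dotcD_le h h') _; lra.
have [c [zc yc]] := zyseq_surj z0 y0 zout yout zy0 z4 y16.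
exists c => k; rewrite leq_eqVlt => /predU1P[->|kn].
  by rewrite corner_last ?cone_emb_eq.
by rewrite /corner zc yc vE // -Mq.
Qed.

Lemma near_Delta_polygon B :
  (forall k, (k < n)%N -> 1 < Re (\tr (partial_prod (\val B) k.*2))) ->
  (forall k, (k < n)%N ->
     1 < Re (\tr ((partial_prod (\val B) 1)^t* *m partial_prod (\val B) k.*2.+1))) ->
  exists g c, polygon g c = B.
Proof.
move=> hE hO; have [trB prodB] : K_set (\val B) := set_valP B.
have n2 : (0 < 2 * n)%N by lia.
have B1 : partial_prod (\val B) 1 = \val B (Ordinal n2).
  by rewrite (partial_prodS _ (Ordinal n2)) partial_prod0 mul1mx.
have [g gJ] := J_transitive (trB (Ordinal n2)); rewrite -B1 in gJ.
have [G eG] : exists G, G = \val g by eexists.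
rewrite -eG in gJ; rename gJ into GJ.
have SG : SU2_set G by rewrite eG; exact: SU2P.
have [gg' g'g] := SU2_mulJ SG.
have [P PE] : exists P : nat -> 'M[C]_2, forall k, P k = partial_prod (\val B) k.
  by eexists.
have SP k : SU2_set (P k).
  by rewrite PE; apply: partial_prod_SU2 => i; have [] := trB i.
have PS (i : 'I_(2 * n)) : P i.+1 = P i *m \val B i by rewrite !PE partial_prodS.
have P0 : P 0%N = 1 by rewrite PE partial_prod0.
have Pn : P (2 * n)%N = 1 by rewrite PE partial_prod_full.
rewrite -PE in GJ.
have trc (X : 'M[C]_2) : \tr (G^t* *m X *m G) = \tr X.
  by rewrite mxtrace_mulC mulmxA gg' mul1mx.
have [c cE] : exists c : Cone, forall k, (k <= 2 * n)%N ->
    corner (cone_emb c) k = G^t* *m P k *m G.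
  apply: corner_surj.
  - by move=> k; apply: SU2_setM => //; apply: SU2_setM => //; exact: SU2_setV.
  - by rewrite P0 mulmx1.
  - by rewrite GJ !mulmxA g'g mul1mx -mulmxA g'g mulmx1.
  - by rewrite Pn mulmx1.
  - move=> k kn; rewrite (PS (Ordinal kn)) conj_ratio // trc.
    by have [] := trB (Ordinal kn).
  - by move=> k kn; rewrite trc PE hE.
  - move=> k kn; have := hO _ kn; rewrite -!PE GJ !trmxCM trmxCKC.
    by rewrite -mulmxA mxtrace_mulC !mulmxA.
exists g, c; apply: val_inj; apply/funext => i.
rewrite /= /edges -eG !cE //; last exact: ltnW.
rewrite -(mulmxA G) PS conj_ratio //.
by rewrite !mulmxA gg' mul1mx -mulmxA gg' mulmx1.
Qed.

End neighbourhood.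

Section K_topology.
Variables (R : realType) (m : nat).
Local Notation C := R[i].

Lemma K_entry_continuous (i : 'I_m) : continuous (fun B : K R m => \val B i).
Proof.
exact: (continuous_compose (@set_val_continuous _ (@K_set R m))
  (@proj_continuous _ (fun _ : 'I_m => 'M[C]_2 : topologicalType) i)).
Qed.

Lemma partial_prod_continuous k :
  continuous (fun B : K R m => partial_prod (\val B) k).
Proof.
elim: k => [|k IH].
  have -> : (fun B : K R m => partial_prod (\val B) 0) = fun=> 1.
    by apply/funext => B; rewrite partial_prod0.
  exact: cst_continuous.
have -> : (fun B : K R m => partial_prod (\val B) k.+1) =
    fun B => partial_prod (\val B) k *m
      (if insub k is Some j then \val B j else 1).
  by apply/funext => B; rewrite /partial_prod big_ord_recr.
have cB : continuous (fun B : K R m => if insub k is Some j then \val B j else 1).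
  by case: (insub k) => [j|]; [exact: (K_entry_continuous (i := j))|exact: cst_continuous].
exact: (mx_continuousM IH cB).
Qed.

Lemma K_subset_hausdorff (U : set (K R m)) : hausdorff_space U.
Proof.
apply: (@hausdorff_separating _ R) => x y xy; apply: val_inj; apply: val_inj.
apply/funext => i; apply/matrixP => j k.
have c := mx_continuous_entry (i := j) (j := k)
  (continuous_compose (@set_val_continuous _ U) (K_entry_continuous (i := i))).
by apply/eqP; rewrite eq_complex (xy _ (complex_continuousRe c))
  (xy _ (complex_continuousIm c)) !eqxx.
Qed.

End K_topology.

Lemma Delta_interior (R : realType) (n : nat) (n_gt0 : (0 < n)%N) :
  Delta R (2 * n) `<=` interior (range (@bundle_polygon R n)).
Proof.
rewrite -(polygon_vertex_Delta R n) => _ [g _ <-].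
set B := polygon g vertex.
pose FE k := fun B : K R (2 * n) => Re (\tr (partial_prod (\val B) k)).
pose FO k := fun B : K R (2 * n) =>
  Re (\tr ((partial_prod (\val B) 1)^t* *m partial_prod (\val B) k)).
have cE k : continuous (FE k) :=
  complex_continuousRe (mx_continuous_tr (@partial_prod_continuous R _ k)).
have cO k : continuous (FO k) := complex_continuousRe (mx_continuous_tr (mx_continuousM
  (mx_continuousJ (@partial_prod_continuous R _ 1)) (@partial_prod_continuous R _ k))).
have near1 (F : K R (2 * n) -> R) : continuous F -> F B = 2 ->
    \forall B' \near B, 1 < F B'.
  move=> cF FB; apply: (cF B [set x | 1 < x]).
  apply: open_nbhs_nbhs; split; first exact: open_gt.
  by rewrite /= FB ltr1n.
have tr1 : Re (\tr (1 : 'M[R[i]]_2)) = 2 by rewrite mxtrace1.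
have EB k : (k <= 2 * n)%N -> partial_prod (\val B) k =
    \val g *m (if odd k then Jmx R else 1) *m (\val g)^t*.
  by move=> kn; have := partial_prod_edges g (cone_emb vertex) kn; rewrite corner_vertex.
have nE (k : 'I_n) : \forall B' \near B, 1 < FE k.*2 B'.
  apply: (near1 (FE k.*2) (@cE _)).
  rewrite /FE EB; last by have := ltn_ord k; lia.
  by rewrite odd_double mxtrace_conjSU2.
have nO (k : 'I_n) : \forall B' \near B, 1 < FO k.*2.+1 B'.
  apply: (near1 (FO k.*2.+1) (@cO _)).
  have kn := ltn_ord k.
  rewrite /FO !EB /= ?odd_double /=; [|lia|lia].
  by have [_ ->] := SU2_mulJ (conjJ_traceless g).1.
have {}nE := filter_forall (nbhs_filter B) nE.
have {}nO := filter_forall (nbhs_filter B) nO.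
rewrite /interior /=; near=> B'.
have [//|//|g' [c' <-]] := @near_Delta_polygon R n n_gt0 B'.
- by move=> k kn; have /(_ (Ordinal kn)) : forall k : 'I_n, 1 < FE k.*2 B' by near: B'.
- by move=> k kn; have /(_ (Ordinal kn)) : forall k : 'I_n, 1 < FO k.*2.+1 B' by near: B'.
exists (\pi_(bundle (cone_action R n)) (g', c')) => //; exact: bundle_polygon_pi.
Unshelve. all: by end_near. Qed.

Lemma bundle_polygon_inj (R : realType) (n : nat) : (0 < n)%N ->
  injective (@bundle_polygon R n).
Proof.
move=> n_gt0 q q'; rewrite -[q]reprK -[q']reprK.
case: (repr q) (repr q') => g c [g' c']; rewrite !bundle_polygon_pi.
move=> /(polygon_inj n_gt0)[t [-> ->]]; apply/eqmodP/asboolP.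
by exists t.
Qed.

Theorem theoremA7 (R : realType) (n : nat) (hn : (1 <= n)%N) :
  exists a : torus_action R
      (cone R (sphere R (2 * n - 2) * sphere R (2 * n - 2))%type),
    (forall t, a t vertex = vertex) /\
    exists U : set (K R (2 * n)),
      Delta R (2 * n) `<=` interior U /\
      exists (h : bundle a -> U) (k : U -> bundle a),
        [/\ continuous h, continuous k, cancel h k, cancel k h &
            [set \val (h (bundle_point a g vertex)) | g in [set: SU2 R]] =
            Delta R (2 * n)].
Proof.
exists (cone_action R n); split; first exact: cone_act_vertex.
exists (range (@bundle_polygon R n)); split; first exact: Delta_interior.
set U := range _.
have hU q : U (bundle_polygon q) by exists q.
pose h (q : bundle (cone_action R n)) : U := SigSub (mem_set (hU q)).
have ex (x : U) : exists q, bundle_polygon q = \val x.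
  by have [q _ qx] := set_valP x; exists q.
pose k (x : U) := projT1 (cid (ex x)).
have kh : cancel k h by move=> x; apply: val_inj; rewrite /= /k; case: cid.
have h_inj : injective h.
  by move=> q q' /(congr1 val); exact: bundle_polygon_inj.
have hk : cancel h k by move=> q; apply: h_inj; exact: kh.
have ch : continuous h.
  by apply: set_type_continuous; exact: bundle_polygon_continuous.
exists h, k; split => //.
- apply: (compact_lift_continuous (@bundle_compact R n)
    (@K_subset_hausdorff R _ U) ch h_inj).
  have -> : h \o k = id by apply/funext.
  by move=> x; exact: cvg_id.
- rewrite -(polygon_vertex_Delta R n); apply: eq_imagel => g _.
  exact: bundle_polygon_pi.
Qed.
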